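(* Let $i\in\{-1,0,1\}$ and let $D$ be a divisor in $\operatorname{Pic}(X_{n,s})$. Then $D$ is a divisorial $(i)$ class if and only if $D$ is an $(i)$ Weyl divisor. In particular, the Weyl group $W_{n,s}$ acts transitively on the set of divisorial $(i)$ classes.
   Context: Let $n\ge 2$. $X_{n,s}$ denotes the blow up of $\mathbb{P}^n$ in a collection of $s$ points $p_1,\dots,p_s$ in general position. $\operatorname{Pic}(X_{n,s})$ is generated by $H,E_1,\dots,E_s$, where $H$ is a general hyperplane class and $E_j$ is the exceptional divisor corresponding to $p_j$. The Dolgachev-Mukai pairing on $\operatorname{Pic}(X_{n,s})$ is the symmetric bilinear form with $\langle H,H\rangle=n-1$, $\langle H,E_j\rangle=0$, $\langle E_j,E_k\rangle=-\delta_{j,k}$. The canonical divisor is $K_{X_{n,s}}=-(n+1)H+(n-1)\sum_j E_j$. For $D=dH-\sum_{j=1}^s m_jE_j$ one has $\langle D,D\rangle=(n-1)d^2-\sum_j m_j^2$, and one puts $\operatorname{adeg}(D)=\frac{1}{n-1}\langle D,-K_{X_{n,s}}\rangle=(n+1)d-\sum_j m_j$. For $i\in\{-1,0,1\}$, a divisorial $(i)$ class on $X_{n,s}$ is an effective and irreducible divisor $D$ (possibly non-reduced) satisfying $\langle D,D\rangle=i$ and $\operatorname{adeg}(D)=2+i$. The Weyl group $W_{n,s}$ is the group of automorphisms of $\operatorname{Pic}(X_{n,s})$ generated by the simple reflections $T_1,\dots,T_s$. When $s\ge n+1$ these are given as follows: for $j<s$, $T_j$ exchanges $E_j$ and $E_{j+1}$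 and fixes the other basis elements; and $T_s(H)=nH-(n-1)\sum_{k=1}^{n+1}E_k$, $T_s(E_j)=H-\sum_{1\le k\le n+1,\,k\ne j}E_k$ for $j\le n+1$, $T_s(E_j)=E_j$ for $j>n+1$ (so $T_s$ is the action of the standard Cremona transformation based at the first $n+1$ points). No separate description of the generators is given for $s\le n$. A divisor $D$ is an $(i)$ Weyl divisor if there exists $w\in W_{n,s}$ with $D=w(H_{n-1-i})$, where $H_{n-1-i}$ is (the proper transform of) a hyperplane passing through $n-1-i$ of the points $p_1,\dots,p_s$.
   Formalization: Assumes s ≥ n+1, since W_{n,s} is defined only then (with permutations alone, E_1 is a counterexample for i = -1); general position means a nonempty open set of points for each D, and very general points for all D at once and for transitivity. *)

(* Defs.v *)
(* MathComp, with multinomials for polynomials in several variables. *)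
From mathcomp Require Import all_boot all_order all_algebra all_fingroup.
From mathcomp.multinomials Require Import mpoly.

Set Implicit Arguments.
Unset Strict Implicit.
Unset Printing Implicit Defensive.

Import Order.TTheory GRing.Theory Num.Theory.
Local Open Scope ring_scope.

(* The free abelian group on H, E_1, ..., E_s.  The pair (d, m) stands for
   d H - \sum_j m_j E_j: note the sign in front of the E_j.  Points are
   numbered from 0. *)
Notation Pic s := (int * {ffun 'I_s -> int})%type.

Section Lattice.

Variables n s : nat.
Implicit Types (D : Pic s) (j k : 'I_s).

Definition H : Pic s := (1, 0).
Definition E j : Pic s := (0, [ffun k => - (k == j)%:R]).

Definition pairing D D' : int :=
  (n%:Z - 1) * (D.1 * D'.1) - \sum_(j < s) D.2 j * D'.2 j.

Definition canonical : Pic s :=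
  - (H *+ n.+1) + (\sum_(j < s) E j) *+ n.-1.

(* The division is exact, see adegE. *)
Definition adeg D : int := (pairing D (- canonical) %/ (n%:Z - 1))%Z.

(* The endomorphism of Pic sending H to h and each E_j to e j. *)
Definition linear_extension (h : Pic s) (e : 'I_s -> Pic s) D : Pic s :=
  h *~ D.1 - \sum_(j < s) e j *~ D.2 j.

Definition exchange j k : Pic s -> Pic s :=
  linear_extension H (fun l => E (tperm j k l)).

(* The standard Cremona transformation based at the first n + 1 points. *)
Definition cremona : Pic s -> Pic s :=
  linear_extension
    (H *+ n - (\sum_(k < s | (k < n.+1)%N) E k) *+ n.-1)
    (fun j => if (j < n.+1)%N
              then H - \sum_(k < s | (k < n.+1)%N && (k != j)) E k
              else E j).

Inductive simple_reflection : (Pic s -> Pic s) -> Prop :=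
| simple_exchange j k : k = j.+1 :> nat -> simple_reflection (exchange j k)
| simple_cremona : simple_reflection cremona.

(* The subgroup of Aut(Pic) generated by the simple reflections; this is
   W_{n,s} when s >= n + 1. *)
Inductive weyl_group : (Pic s -> Pic s) -> Prop :=
| weyl_id : weyl_group id
| weyl_simple T : simple_reflection T -> weyl_group T
| weyl_comp w w' : weyl_group w -> weyl_group w' -> weyl_group (w \o w')
| weyl_inv w w' :
    weyl_group w -> cancel w w' -> cancel w' w -> weyl_group w'.

Definition hyperplane_through (J : {set 'I_s}) : Pic s := H - \sum_(j in J) E j.

Definition weyl_divisor (i : int) D : Prop :=
  exists w (J : {set 'I_s}),
    [/\ weyl_group w, #|J|%:Z = n%:Z - 1 - i & D = w (hyperplane_through J)].

Definition weyl_acts_transitively (A : Pic s -> Prop) : Prop :=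
  (forall w D, weyl_group w -> A D -> A (w D)) /\
  (forall D D', A D -> A D' -> exists2 w, weyl_group w & w D = D').

End Lattice.

Section Geometry.

Variables (K : closedFieldType) (n s : nat).

Definition mpoly_irreducible (F : {mpoly K[n.+1]}) : Prop :=
  [/\ F != 0, F \isn't a GRing.unit &
      forall A B, F = A * B -> A \is a GRing.unit \/ B \is a GRing.unit].

Record hypersurface : Type := Hypersurface {
  hyp_deg : nat;
  hyp_eqn : {mpoly K[n.+1]};
  hyp_homog : hyp_eqn \is hyp_deg.-homog;
  hyp_irr : mpoly_irreducible hyp_eqn
}.

(* The least degree of a monomial of F(x + X).  For F homogeneous and x
   nonzero this is the multiplicity of {F = 0} at the point [x] of P^n: the
   affine cone is locally the product of the hypersurface with a line.
   (Derivatives are avoided because K may have positive characteristic.) *)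
Definition translate (x : 'rV[K]_n.+1) (F : {mpoly K[n.+1]}) :
    {mpoly K[n.+1]} :=
  F \mPo [tuple 'X_k + (x 0 k)%:MP | k < n.+1].

Definition multiplicity (x : 'rV[K]_n.+1) (F : {mpoly K[n.+1]}) : nat :=
  let G := translate x F in
  \big[minn/msize G]_(m <- msupp G) mdeg m.

(* Row j of a configuration is a vector of homogeneous coordinates of p_j. *)
Definition config : Type := 'M[K]_(s, n.+1).

(* The prime divisors on the blow-up of P^n at s distinct points: a prime
   divisor that is not exceptional is the proper transform of its image. *)
Inductive prime_divisor : Type :=
| Exceptional (j : 'I_s)
| ProperTransform (Y : hypersurface).

Definition divisor_class (p : config) (P : prime_divisor) : Pic s :=
  match P with
  | Exceptional j => E j
  | ProperTransform Y =>
      ((hyp_deg Y)%:Z,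
       [ffun j => (multiplicity (row j p) (hyp_eqn Y))%:Z])
  end.

(* D is the class of r P with P prime and r > 0, i.e. of an effective divisor
   with irreducible, possibly non-reduced, support. *)
Definition effective_irreducible (p : config) (D : Pic s) : Prop :=
  exists (P : prime_divisor) (r : nat),
    (0 < r)%N /\ D = divisor_class p P *+ r.

Definition divisorial_class (p : config) (i : int) (D : Pic s) : Prop :=
  [/\ effective_irreducible p D, pairing n D D = i & adeg n D = 2 + i].

Definition nonvanishing (G : {mpoly K[s * n.+1]}) (p : config) : Prop :=
  G.@[fun k => mxvec p 0 k] != 0.

Definition homogeneous_coordinates (p : config) : Prop :=
  forall j, row j p != 0.

(* Q holds on a nonempty Zariski open set of s-tuples of points.  G need not
   be multihomogeneous: for Q depending only on the points, Q also holds on the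
   image of {G <> 0} in (P^n)^s, which is open. *)
Definition for_general_points (Q : config -> Prop) : Prop :=
  exists2 G : {mpoly K[s * n.+1]}, G != 0 &
    forall p, homogeneous_coordinates p -> nonvanishing G p -> Q p.

(* Q holds on the intersection of countably many such open sets. *)
Definition for_very_general_points (Q : config -> Prop) : Prop :=
  exists2 G : nat -> {mpoly K[s * n.+1]}, (forall r, G r != 0) &
    forall p, homogeneous_coordinates p -> (forall r, nonvanishing (G r) p) -> Q p.

End Geometry.

Lemma pairingHH n s : pairing n (H s) (H s) = n%:Z - 1.
Proof.
rewrite /pairing /= mulr1 mulr1 big1 ?subr0 // => j _.
by rewrite ffunE mul0r.
Qed.

Lemma pairingHE n s (j : 'I_s) : pairing n (H s) (E j) = 0.
Proof.
rewrite /pairing /= big1 ?subr0 ?mulr0 // => k _.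
by rewrite ffunE mul0r.
Qed.

Lemma pairingEE n s (j k : 'I_s) : pairing n (E j) (E k) = - (j == k)%:R.
Proof.
rewrite /pairing /= !mulr0 sub0r (bigD1 j) //= big1 ?addr0.
  by rewrite !ffunE eqxx mulrNN mul1r.
by move=> l /negPf lj; rewrite !ffunE lj oppr0 mul0r.
Qed.

Lemma canonicalE n s : canonical n s = (- n.+1%:Z, [ffun=> - n.-1%:Z]).
Proof.
have MnE (D : int * {ffun 'I_s -> int}) r : D *+ r = (D.1 *+ r, D.2 *+ r).
  by rewrite [LHS]surjective_pairing !raddfMn.
rewrite /canonical.
have -> : \sum_(j < s) E j = (0, [ffun=> -1]) :> Pic s.
  rewrite [LHS]surjective_pairing (raddf_sum fst) (raddf_sum snd) /= big1 //.
  congr (_, _); apply/ffunP => k; rewrite sum_ffunE ffunE (bigD1 k) //=.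
  rewrite big1 ?ffunE ?eqxx ?addr0 // => l /negPf lk.
  by rewrite ffunE eq_sym lk oppr0.
rewrite !MnE /=; congr (_, _); first by rewrite raddfN /= mul0rn addr0 natz.
rewrite raddfN /= mul0rn oppr0 add0r; apply/ffunP => k.
by rewrite ffunMnE !ffunE mulNrn natz.
Qed.

Lemma adegE n s (D : Pic s) : (2 <= n)%N ->
  adeg n D = n.+1%:Z * D.1 - \sum_(j < s) D.2 j.
Proof.
case: n => [|[|n]] // _; have n1E : n.+2%:Z - 1 = n.+1%:Z.
  by rewrite -[n.+2]addn1 PoszD addrK.
rewrite /adeg canonicalE /pairing raddfN /= raddfN /= opprK n1E.
suff -> : \sum_(j < s) D.2 j * (- [ffun=> - n.+1%:Z]) j =
          (\sum_(j < s) D.2 j) * n.+1%:Z.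
  by rewrite mulrC [D.1 * _]mulrC -mulrBl mulzK.
by rewrite mulr_suml; apply: eq_bigr => j _; rewrite !ffunE opprK.
Qed.

Lemma multiplicity_ge (K : closedFieldType) n (x : 'rV[K]_n.+1) F r :
    translate x F != 0 ->
  (r <= multiplicity x F)%N <->
  (forall m : 'X_{1..n.+1}, (mdeg m < r)%N -> (translate x F)@_m = 0).
Proof.
rewrite /multiplicity; set G := translate x F => G0; split=> [le_r m lt_m|G_lt].
  apply: memN_msupp_eq0; apply: contraL lt_m => mG; rewrite -leqNgt.
  apply: leq_trans le_r _; elim: (msupp G : seq _) mG => // m' l IH.
  rewrite inE big_cons => /predU1P[->|/IH]; first exact: geq_minl.
  exact/leq_trans/geq_minr.
have ge_r m : m \in msupp G -> (r <= mdeg m)%N.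
  by rewrite mcoeff_msupp leqNgt; apply: contra => /G_lt ->.
rewrite big_seq; elim/big_ind: _ => // [|a b ra rb]; last by rewrite leq_min ra.
exact: leq_trans (ge_r _ (mlead_supp G0)) (ltnW (msize_mdeg_lt (mlead_supp G0))).
Qed.

(* Main.v *)
Require Import Defs.
From mathcomp Require Import all_boot all_order all_algebra all_fingroup.
From mathcomp Require Import ring zify.
From mathcomp.multinomials Require Import mpoly.
From Stdlib Require Import ClassicalEpsilon.

Set Implicit Arguments.
Unset Strict Implicit.
Unset Printing Implicit Defensive.

Import Order.TTheory GRing.Theory Num.Theory.
Local Open Scope ring_scope.

(** The two numbers [pairing n D D] and [adeg n D] are invariant under the Weyl group,
    and both are right for a hyperplane through n - 1 - i points. So everything rests on
    how the simple reflections act on classes of irreducible divisors. An exchange of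
    [E_j] and [E_(j+1)] only renumbers the points. The reflection [cremona] is realized by the
    standard Cremona transformation based at the first n + 1 points: it takes
    irreducible divisors at a configuration p to irreducible divisors at the transformed
    configuration, and the class D to [cremona n D] ([effective_irreducible_cremona]).

    Weyl divisors are divisorial: a class that is effective and irreducible at general
    points stays so under the simple reflections ([generally_effective_cremona]),
    because a general configuration is the transform of a general configuration, and
    hyperplanes through at most n general points are of this kind.

    Divisorial classes are Weyl divisors: let D be divisorial of degree d with
    multiplicities m_j. If d = 1 then D is a hyperplane through n - 1 - i points. If d
    >= 2, the two numerical conditions force the sum of the n + 1 largest multiplicities
    to exceed (n - 1) d ([noether_inequality]), so after a permutation the Cremona
    transformation lowers the degree, and induction applies. Multiples of the
    exceptional divisors are disposed of by their square.

    The geometry is done with forms. With sigma the substitution of the product of the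
    other variables for each variable, the pull-back of an irreducible form F by sigma
    is a monomial times an irreducible form G ([proper_transform]), unless F is a
    multiple of a variable. The exponents of the monomial are the multiplicities of F at
    the coordinate vertices, and sigma o sigma multiplies all coordinates by one
    monomial, so F and G play symmetric roles. At points with nonzero coordinates,
    multiplicities are preserved because pulling back by a polynomial map never lowers
    them ([multiplicity_comp]).

    A single class needs finitely many open conditions on the points, whence the first
    assertion; as the lattice is countable, very general points satisfy them for all
    classes at once. *)

(** * Order of vanishing of polynomials *)

Section OrderOfVanishing.

Variables (K : closedFieldType) (n : nat).
Implicit Types (F G : {mpoly K[n.+1]}) (g h : n.+1.-tuple {mpoly K[n.+1]}).
Implicit Types (x y : 'rV[K]_n.+1).

Definition order_ge r F := forall m : 'X_{1..n.+1}, (mdeg m < r)%N -> F@_m = 0.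

Definition degree_le d F := forall m : 'X_{1..n.+1}, (d < mdeg m)%N -> F@_m = 0.

Lemma order_ge_sum (I : eqType) (l : seq I) (P : pred I) (F : I -> {mpoly K[n.+1]}) r :
  (forall i, i \in l -> order_ge r (F i)) -> order_ge r (\sum_(i <- l | P i) F i).
Proof.
move=> ord_F m mr; rewrite raddf_sum /= big_seq_cond big1 // => i /andP[il _].
exact: ord_F.
Qed.

Lemma degree_le_sum (I : eqType) (l : seq I) (F : I -> {mpoly K[n.+1]}) r :
  (forall i, i \in l -> degree_le r (F i)) -> degree_le r (\sum_(i <- l) F i).
Proof.
move=> ord_F m mr; rewrite raddf_sum /= big_seq big1 // => i il.
exact: ord_F.
Qed.

Lemma order_geZ r c F : order_ge r F -> order_ge r (c *: F).
Proof. by move=> ord_F m /ord_F e; rewrite mcoeffZ e mulr0. Qed.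

Lemma degree_leZ r c F : degree_le r F -> degree_le r (c *: F).
Proof. by move=> ord_F m /ord_F e; rewrite mcoeffZ e mulr0. Qed.

Lemma mcoeffM_eq0 F G (m : 'X_{1..n.+1}) :
  (forall k l, m = (k + l)%MM -> F@_k * G@_l = 0) -> (F * G)@_m = 0.
Proof. by move=> H; rewrite mcoeffM big1 // => k /eqP /H. Qed.

Lemma order_geM r r' F G : order_ge r F -> order_ge r' G -> order_ge (r + r') (F * G).
Proof.
move=> ordF ordG m mlt; apply: mcoeffM_eq0 => k l mkl.
move: mlt; rewrite mkl mdegD; have [/ordF->|rk] := ltnP (mdeg k) r.
  by rewrite mul0r.
by move=> lt; rewrite (ordG l) ?mulr0 //; lia.
Qed.

Lemma degree_leM r r' F G :
  degree_le r F -> degree_le r' G -> degree_le (r + r') (F * G).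
Proof.
move=> degF degG m mlt; apply: mcoeffM_eq0 => k l mkl.
move: mlt; rewrite mkl mdegD; have [/degF->|rk] := ltnP r (mdeg k).
  by rewrite mul0r.
by move=> lt; rewrite (degG l) ?mulr0 //; lia.
Qed.

Lemma degree_le1 : degree_le 0 1.
Proof. by move=> m; rewrite mcoeff1 -mdeg_eq0; case: (mdeg m). Qed.

Lemma order_ge_prod (r : 'I_n.+1 -> nat) (F : 'I_n.+1 -> {mpoly K[n.+1]}) :
  (forall i, order_ge (r i) (F i)) -> order_ge (\sum_i r i) (\prod_i F i).
Proof. move=> H; apply: (big_ind2 (fun r F => order_ge r F)) => // *; exact: order_geM. Qed.

Lemma degree_le_prod (r : 'I_n.+1 -> nat) (F : 'I_n.+1 -> {mpoly K[n.+1]}) :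
  (forall i, degree_le (r i) (F i)) -> degree_le (\sum_i r i) (\prod_i F i).
Proof.
move=> H; apply: (big_ind2 (fun r F => degree_le r F)) => // *.
  exact: degree_le1.
exact: degree_leM.
Qed.

Lemma order_geX k F : order_ge 1 F -> order_ge k (F ^+ k).
Proof.
move=> H; elim: k => [|k IH] //; rewrite exprS -add1n; exact: order_geM.
Qed.

Lemma degree_leX k F : degree_le 1 F -> degree_le k (F ^+ k).
Proof.
move=> H; elim: k => [|k IH]; first exact: degree_le1.
by rewrite exprS -add1n; exact: degree_leM.
Qed.

(** Monomials of degree r in polynomials without constant term have no term of degree
    less than r. *)
Lemma order_ge_comp r F g :
  (forall i, order_ge 1 (tnth g i)) -> order_ge r F -> order_ge r (F \mPo g).
Proof.
move=> ordg ordF; rewrite comp_mpolyEX; apply: order_ge_sum => m mF.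
apply: order_geZ; rewrite comp_mpolyX.
have rm : (r <= \sum_i m i)%N.
  by rewrite -mdegE leqNgt; apply: contraL mF => /ordF F0; rewrite mcoeff_msupp F0 eqxx.
have H : order_ge (\sum_i m i) (\prod_(i < n.+1) tnth g i ^+ m i).
  by apply: order_ge_prod => i; exact: order_geX.
by move=> u ur; apply: H; exact: leq_trans rm.
Qed.

Lemma degree_le_comp d F g :
  (forall i, degree_le 1 (tnth g i)) -> F \is d.-homog -> degree_le d (F \mPo g).
Proof.
move=> degg /dhomogP homF; rewrite comp_mpolyEX; apply: degree_le_sum => m mF.
apply: degree_leZ; rewrite comp_mpolyX -(homF _ mF) /= mdegE.
by apply: degree_le_prod => i; exact: degree_leX.
Qed.

Lemma comp_mpolyA F g h : (F \mPo g) \mPo h = F \mPo [tuple tnth g i \mPo h | i < n.+1].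
Proof.
rewrite !(comp_mpolyEX F) raddf_sum /=; apply: eq_bigr => m _.
rewrite comp_mpolyZ !comp_mpolyX rmorph_prod /=; congr (_ *: _).
by apply: eq_bigr => i _; rewrite rmorphXn /= tnth_mktuple.
Qed.

Lemma comp_mpoly_eq F g h : (forall i, tnth g i = tnth h i) -> F \mPo g = F \mPo h.
Proof. by move=> e; congr (_ \mPo _); exact: eq_from_tnth. Qed.

Lemma comp_mpolyU i g : 'X_i \mPo g = tnth g i.
Proof. by rewrite comp_mpolyXU -tnth_nth. Qed.

Lemma mcoeff_at0 F : F@_0%MM = F.@[fun=> 0].
Proof.
rewrite [F in RHS]mpolyE raddf_sum /= [F in LHS]mpolyE raddf_sum /=.
apply: eq_bigr => m _; rewrite mevalZ mcoeffZ mevalX mcoeffX; congr (_ * _).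
case: eqP => [->|/eqP]; first by rewrite big1 // => i _; rewrite mnm0E.
rewrite -mdeg_eq0 mdegE sum_nat_eq0 => /forallPn[i /= mi].
by rewrite (bigD1 i) //= expr0n (negPf mi) mul0r.
Qed.

Definition polymap g y : 'rV[K]_n.+1 := \row_k (tnth g k).@[fun i => y 0 i].

Lemma comp_meval F g y : (F \mPo g).@[y 0] = F.@[polymap g y 0].
Proof.
by rewrite comp_mpoly_meval; apply: meval_eq => i; rewrite mxE.
Qed.

Lemma translate_eval y F : (translate y F)@_0%MM = F.@[y 0].
Proof.
rewrite mcoeff_at0 comp_mpoly_meval; apply: meval_eq => i.
by rewrite tnth_mktuple mevalD mevalXU mevalC add0r.
Qed.

(** With arguments written additively, [F (g (y + X)) = F (g y + D)] with [D = g (y + X)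
    - g y], and D has no constant term, so substituting it cannot lower the order. This
    semicontinuity, used for a map and for an inverse of it, is the only way in which
    multiplicities at points outside the coordinate vertices are compared below. *)
Lemma order_ge_translate_comp g y F r :
  order_ge r (translate (polymap g y) F) -> order_ge r (translate y (F \mPo g)).
Proof.
pose D := [tuple translate y (tnth g k) - ((tnth g k).@[y 0])%:MP | k < n.+1].
have -> : translate y (F \mPo g) = translate (polymap g y) F \mPo D.
  rewrite /translate !comp_mpolyA; apply: comp_mpoly_eq => k.
  rewrite !tnth_mktuple comp_mpolyD comp_mpolyC mxE comp_mpolyU tnth_mktuple.
  by rewrite subrK.
apply: order_ge_comp => k m; rewrite ltnS leqn0 mdeg_eq0 => /eqP ->.
by rewrite tnth_mktuple mcoeffB translate_eval mcoeffC eqxx mulr1 subrr.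
Qed.

Lemma translateK y : cancel (translate y) (translate (- y)).
Proof.
move=> F; rewrite /translate comp_mpolyA -[RHS]comp_mpoly_id.
apply: comp_mpoly_eq => k; rewrite !tnth_mktuple comp_mpolyD comp_mpolyC comp_mpolyU.
by rewrite tnth_mktuple mxE mpolyCN addrNK.
Qed.

Lemma translate_neq0 y F : F != 0 -> translate y F != 0.
Proof.
apply: contra_neq => e; rewrite -(translateK y F) e /translate.
exact: comp_mpoly0.
Qed.

Lemma le_multiplicity y F r : F != 0 ->
  (r <= multiplicity y F)%N <-> order_ge r (translate y F).
Proof. by move/(translate_neq0 y); exact: multiplicity_ge. Qed.

Lemma multiplicity_comp g y F : F != 0 -> F \mPo g != 0 ->
  (multiplicity (polymap g y) F <= multiplicity y (F \mPo g))%N.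
Proof.
move=> F0 Fg0; apply/le_multiplicity => //; apply: order_ge_translate_comp.
exact/le_multiplicity.
Qed.

Lemma eq_multiplicity x y F G : F != 0 -> G != 0 ->
  (forall r, order_ge r (translate x F) <-> order_ge r (translate y G)) ->
  multiplicity x F = multiplicity y G.
Proof.
move=> F0 G0 e; apply/eqP; rewrite eqn_leq; apply/andP; split.
  by apply/le_multiplicity => //; apply/e; exact/le_multiplicity.
by apply/le_multiplicity => //; apply/e; exact/le_multiplicity.
Qed.

(** By induction on the degree e: if the terms of F of degree less than e vanish, the
    terms of degree e of [F * G] are those of F times the nonzero constant term of G. *)
Lemma order_ge_cancel r F G : G@_0%MM != 0 -> order_ge r (F * G) -> order_ge r F.
Proof.
move=> G0 ordFG m; elim: {m}(mdeg m).+1 {-2}m (ltnSn (mdeg m)) => // e IH m me mr.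
have := ordFG m mr; rewrite mcoeffM.
have b2 : (mdeg (0%MM : 'X_{1..n.+1}) < (mdeg m).+1)%N by rewrite mdeg0.
rewrite (bigD1 (BMultinom (ltnSn (mdeg m)), BMultinom b2)) /=; last by rewrite addm0.
rewrite big1 ?addr0; last first.
  move=> [k l] /= /andP[/eqP mkl ne]; have dm := congr1 (@mdeg _) mkl.
  rewrite mdegD in dm; have l0 : (mdeg l != 0)%N.
    rewrite mdeg_eq0; apply: contra ne => /eqP l0.
    rewrite xpair_eqE !bmeqP /= l0 eqxx andbT eq_sym; apply/eqP.
    by apply: etrans mkl _; rewrite l0 addm0.
  by rewrite (IH k) ?mul0r //; lia.
by move/eqP; rewrite mulf_eq0 (negPf G0) orbF => /eqP.
Qed.

Lemma translateM y F G : translate y (F * G) = translate y F * translate y G.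
Proof. exact: rmorphM. Qed.

Lemma multiplicity_mulr y F G : F != 0 -> G.@[y 0] != 0 ->
  multiplicity y (F * G) = multiplicity y F.
Proof.
move=> F0 Gy; have G0 : G != 0 by apply: contra_neq Gy => ->; rewrite meval0.
apply: eq_multiplicity; rewrite ?mulf_neq0 // => r; rewrite translateM; split.
  by apply: order_ge_cancel; rewrite translate_eval.
by move=> ordF; rewrite -[r]addn0; exact: order_geM.
Qed.

Lemma multiplicity_eq0 y F : F.@[y 0] != 0 -> multiplicity y F = 0%N.
Proof.
move=> Fy; have F0 : F != 0 by apply: contra_neq Fy => ->; rewrite meval0.
apply/eqP; rewrite -leqn0 leqNgt; apply: contra Fy => /le_multiplicity -/(_ F0).
by move=> /(_ 0%MM); rewrite mdeg0 translate_eval => ->.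
Qed.

Lemma multiplicity_le_deg y F d : F != 0 -> F \is d.-homog ->
  (multiplicity y F <= d)%N.
Proof.
move=> F0 homF; rewrite leqNgt; apply/negP => /le_multiplicity -/(_ F0) ordF.
have : translate y F = 0; last by apply/eqP; exact: translate_neq0.
apply/mpolyP => m; rewrite mcoeff0; have [md|/ordF//] := ltnP d (mdeg m).
apply: (degree_le_comp _ homF) md => i u u1; rewrite tnth_mktuple mcoeffD mcoeffC.
rewrite mcoeffX; case: eqP => [e|_]; first by rewrite -e mdeg1 in u1.
by case: eqP => [e|_]; [rewrite e mdeg0 in u1|rewrite mulr0 addr0].
Qed.

(** The substitution [X_j := a]. For a = 0 it is the test for divisibility by X_j, for a
    = 1 it is the passage to the affine chart [X_j = 1]. *)
Definition set_to (j : 'I_n.+1) (a : K) : n.+1.-tuple {mpoly K[n.+1]} :=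
  [tuple if k == j then a%:MP else 'X_k | k < n.+1].

Definition forget (j : 'I_n.+1) (m : 'X_{1..n.+1}) : 'X_{1..n.+1} :=
  [multinom if k == j then 0%N else m k | k < n.+1].

Lemma comp_set_toX j a m : 'X_[m] \mPo set_to j a = a ^+ m j *: 'X_[forget j m].
Proof.
rewrite comp_mpolyX mpolyXE_id (bigD1 j) //= [in RHS](bigD1 j) //= mnmE eqxx mul1r.
rewrite tnth_mktuple eqxx -mul_mpolyC rmorphXn; congr (_ * _).
by apply: eq_bigr => k /negPf kj; rewrite tnth_mktuple mnmE kj.
Qed.

Lemma forget_id (j : 'I_n.+1) (m : 'X_{1..n.+1}) : m j = 0%N -> forget j m = m.
Proof. by move=> mj; apply/mnmP => k; rewrite mnmE; case: eqP => // ->. Qed.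

Lemma mdeg_forget (j : 'I_n.+1) (m : 'X_{1..n.+1}) : mdeg m = (m j + mdeg (forget j m))%N.
Proof.
rewrite !mdegE (bigD1 j) //= [in RHS](bigD1 j) //= mnmE eqxx add0n; congr addn.
by apply: eq_bigr => k /negPf kj; rewrite mnmE kj.
Qed.

Lemma mcoeff_set0 j F (m : 'X_{1..n.+1}) :
  (F \mPo set_to j 0)@_m = if m j == 0%N then F@_m else 0.
Proof.
rewrite comp_mpolyEX raddf_sum /= [F in RHS]mpolyE raddf_sum /=.
transitivity (\sum_(u <- msupp F) if m j == 0%N then F@_u * (u == m)%:R else 0).
  apply: eq_bigr => u _; rewrite !mcoeffZ comp_set_toX mcoeffZ mcoeffX expr0n.
  have [uj|uj] := eqVneq (u j) 0%N; rewrite ?mul0r ?mulr0 ?mul1r.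
    rewrite forget_id //; have [e|] := eqVneq u m; last by rewrite mulr0; case: ifP.
    by rewrite -e uj.
  case: ifP => // /eqP mj; have [e|] := eqVneq u m; last by rewrite mulr0.
  by rewrite -e in mj; rewrite mj in uj.
case: ifP => _; last by rewrite big1.
by apply: eq_bigr => u _; rewrite mcoeffZ mcoeffX.
Qed.

(** At the vertex e_j, a monomial of degree d involving [X_j ^ a] vanishes to order d -
    a, and different monomials of F do not cancel: their restrictions to [X_j = 1] are
    distinct because F is homogeneous. *)
Lemma order_ge_vertex j d F r : F \is d.-homog ->
  order_ge r (translate (delta_mx 0 j) F) <->
  (forall m, m \in msupp F -> (m j + r <= d)%N).
Proof.
move=> homF; have /dhomogP hom := homF; split=> [ordF m mF|Fle]; last first.
  rewrite /translate comp_mpolyEX; apply: order_ge_sum => m mF; apply: order_geZ.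
  rewrite comp_mpolyX; set t := mktuple _; pose e := (forget j m).
  have H : order_ge (\sum_i e i) (\prod_(i < n.+1) tnth t i ^+ m i).
    apply: (order_ge_prod (r := fun i => e i)) => i.
    rewrite mnmE tnth_mktuple mxE eqxx /=.
    case: eqP => [//|_]; rewrite mpolyC0 addr0; apply: order_geX => u.
    rewrite ltnS leqn0 mcoeffX mdeg_eq0 => /eqP ->.
    by rewrite mnm1_eq0.
  move=> u ur; apply: H; rewrite -mdegE; apply: leq_trans ur _.
  by have := Fle _ mF; rewrite -(hom _ mF) /= (mdeg_forget j m) -/e leq_add2l.
rewrite leqNgt; apply/negP => ltd.
have e0 : (translate (delta_mx 0 j) F \mPo set_to j 0)@_(forget j m) = 0.
  rewrite mcoeff_set0; case: ifP => // _; apply: ordF.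
  by move: ltd; rewrite -(hom _ mF) /= (mdeg_forget j m) ltn_add2l.
(* Translating to e_j and then setting X_j to 0 is the dehomogenization. *)
have e1 : translate (delta_mx 0 j) F \mPo set_to j 0 = F \mPo set_to j 1.
  rewrite /translate comp_mpolyA; apply: comp_mpoly_eq => k; rewrite !tnth_mktuple.
  rewrite comp_mpolyD comp_mpolyC comp_mpolyU !mxE tnth_mktuple eqxx /=.
  by case: eqP => _; rewrite ?mpolyC0 ?add0r ?addr0 ?mpolyC1.
move: e0; rewrite e1 comp_mpolyEX raddf_sum /= (bigD1_seq m) ?msupp_uniq //=.
rewrite big_seq_cond big1 ?addr0; last first.
  move=> u /andP[uF /eqP um]; rewrite mcoeffZ comp_set_toX expr1n scale1r mcoeffX.
  case: eqP => [e|]; last by rewrite mulr0.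
  case: um; apply/mnmP => k; have [->|kj] := eqVneq k j.
    have := hom _ uF; rewrite -(hom _ mF) /= (mdeg_forget j m) (mdeg_forget j u) e.
    by move/eqP; rewrite eqn_add2r => /eqP.
  by have /mnmP/(_ k) := e; rewrite !mnmE (negPf kj).
rewrite mcoeffZ comp_set_toX expr1n scale1r mcoeffX eqxx mulr1 => /eqP.
by rewrite mcoeff_eq0 mF.
Qed.

Lemma multiplicity_vertex j d F : F != 0 -> F \is d.-homog ->
  (forall m : 'X_{1..n.+1}, m \in msupp F -> (m j + multiplicity (delta_mx 0%R j) F <= d)%N) /\
  (exists2 m : 'X_{1..n.+1}, m \in msupp F & (m j + multiplicity (delta_mx 0%R j) F = d)%N).
Proof.
move=> F0 homF; set mu := multiplicity _ F.
have le (m : 'X_{1..n.+1}) : m \in msupp F -> (m j + mu <= d)%N.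
  by move: m; apply/(order_ge_vertex j _ homF); exact/le_multiplicity.
split=> //; have : ~~ (mu.+1 <= mu)%N by rewrite ltnn.
case: (altP (@hasP _ (fun m : 'X_{1..n.+1} => m j + mu == d)%N (msupp F))).
  by case=> m mF /eqP e _; exists m.
move=> /hasPn no /negP[]; apply/le_multiplicity => //.
apply/(order_ge_vertex j _ homF) => m mF; rewrite addnS ltn_neqAle.
by rewrite no //= le.
Qed.

End OrderOfVanishing.

(** * Monomial factors *)

Section MonomialFactors.

Variables (K : closedFieldType) (n : nat).
Implicit Types (F G A B : {mpoly K[n.+1]}) (a b m u mu : 'X_{1..n.+1}).

Definition var_ndvd (k : 'I_n.+1) F := has (fun m : 'X_{1..n.+1} => m k == 0%N) (msupp F).

Definition monomial_free F := forall k, var_ndvd k F.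

(** X_k does not divide F exactly when F survives the ring morphism [X_k := 0], whose
    values lie in a domain; this makes X_k prime without any theory of factorial rings. *)
Lemma var_ndvdE k F : var_ndvd k F = (F \mPo set_to k 0 != 0).
Proof.
apply/hasP/idP => [[m mF mk]|].
  apply: contraTneq mF => /(congr1 (mcoeff m)).
  by rewrite mcoeff_set0 mk mcoeff0 mcoeff_msupp => ->; rewrite eqxx.
rewrite -msupp_eq0; case E: (msupp _) => [//|m l] _; exists m.
  have : m \in msupp (F \mPo set_to k 0) by rewrite E mem_head.
  by rewrite !mcoeff_msupp mcoeff_set0; case: ifP; rewrite ?eqxx.
have : m \in msupp (F \mPo set_to k 0) by rewrite E mem_head.
by rewrite mcoeff_msupp mcoeff_set0; case: ifP; rewrite ?eqxx.
Qed.

Lemma var_ndvdM k A B : var_ndvd k (A * B) = var_ndvd k A && var_ndvd k B.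
Proof. by rewrite !var_ndvdE rmorphM /= mulf_eq0 negb_or. Qed.

Lemma monomial_free_neq0 F : monomial_free F -> F != 0.
Proof.
move=> /(_ 0); apply: contraTneq => ->; rewrite var_ndvdE.
by rewrite comp_mpoly0 eqxx.
Qed.

Lemma mem_msuppXM mu G m : (m \in msupp ('X_[mu] * G)) = (mu <= m)%MM && ((m - mu)%MM \in msupp G).
Proof.
rewrite mulrC (perm_mem (msuppMX G mu)); apply/mapP/andP.
  by move=> [u uG ->]; rewrite lem_addr addmC addmK.
by move=> [le H]; exists (m - mu)%MM => //; rewrite addmC submK.
Qed.

Lemma mpolyX_factor mu F : (forall m, m \in msupp F -> (mu <= m)%MM) ->
  exists G, F = 'X_[mu] * G.
Proof.
move=> le; exists (\sum_(m <- msupp F) F@_m *: 'X_[m - mu]).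
rewrite {1}[F]mpolyE mulr_sumr big_seq [RHS]big_seq; apply: eq_bigr => m /le mF.
by rewrite -scalerAr -mpolyXD addmC submK.
Qed.

Lemma factor_monomial F : F != 0 -> exists mu G, F = 'X_[mu] * G /\ monomial_free G.
Proof.
move=> F0; have H k : exists v, has (fun m : 'X_{1..n.+1} => m k == v) (msupp F).
  by exists (mlead F k); apply/hasP; exists (mlead F); rewrite ?mlead_supp.
pose mu := [multinom ex_minn (H k) | k < n.+1].
have [m mF|G FE] := @mpolyX_factor mu F.
  apply/mnm_lepP => k; rewrite mnmE; case: ex_minnP => v _; apply.
  by apply/hasP; exists m.
exists mu, G; split=> // k; have : mu k = ex_minn (H k) by rewrite mnmE.
case: ex_minnP => v /hasP[m mF /eqP mk] _ muk; apply/hasP; exists (m - mu)%MM.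
  by move: mF; rewrite FE mem_msuppXM => /andP[].
by rewrite mnmBE mk muk subnn.
Qed.

Lemma monomial_factor_unique a b F G : monomial_free F -> monomial_free G ->
  'X_[a] * F = 'X_[b] * G -> a = b /\ F = G.
Proof.
suff le a' b' F' G' : monomial_free F' -> 'X_[a'] * F' = 'X_[b'] * G' -> (b' <= a')%MM.
  move=> mF mG e; have ab : a = b.
    apply/mnmP => k; apply/eqP; rewrite eqn_leq.
    by rewrite (mnm_lepP (le _ _ _ _ mF e)) (mnm_lepP (le _ _ _ _ mG (esym e))).
  split=> //; move: e; rewrite ab; apply: mulfI.
  by rewrite -msupp_eq0 msuppX.
move=> mF e; apply/mnm_lepP => k; have /hasP[m mF' /eqP mk] := mF k.
have : (a' + m)%MM \in msupp ('X_[b'] * G').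
  by rewrite -e mem_msuppXM lem_addr addmC addmK.
by rewrite mem_msuppXM => /andP[/mnm_lepP/(_ k)]; rewrite mnmDE mk addn0.
Qed.

(** The variables are prime, so all of the monomial can be taken out of A and B. *)
Lemma monomial_factor_split nu F A B : monomial_free F -> A * B = 'X_[nu] * F ->
  exists a b A' B', [/\ A = 'X_[a] * A', B = 'X_[b] * B' & A' * B' = F].
Proof.
move=> mF e; have F0 := monomial_free_neq0 mF.
have : A * B != 0 by rewrite e mulf_neq0 // -msupp_eq0 msuppX.
rewrite mulf_eq0 negb_or => /andP[/factor_monomial[a [A' [EA mA]]]].
move=> /factor_monomial[b [B' [EB mB]]]; exists a, b, A', B'; split=> //.
have e' : 'X_[a + b] * (A' * B') = 'X_[nu] * F.
  by rewrite -e EA EB mpolyXD; ring.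
have [|_ //] := monomial_factor_unique _ mF e'.
by move=> k; rewrite var_ndvdM mA mB.
Qed.

Lemma mpoly_unitP F : reflect (exists2 c, c != 0 & F = c%:MP) (F \is a GRing.unit).
Proof.
rewrite unfold_in /= /mpoly_unit; apply: (iffP andP) => [[/eqP e u]|[c c0 ->]].
  by exists (F@_0%MM) => //; rewrite -unitfE.
by rewrite mpolyCK eqxx unitfE.
Qed.

Lemma mpolyX_unit k : ('X_k : {mpoly K[n.+1]}) \isn't a GRing.unit.
Proof.
apply/mpoly_unitP => -[c _ /(congr1 (mcoeff U_(k)))].
rewrite mcoeffX mcoeffC eqxx mnm1_eq0 mulr0 => /eqP.
by rewrite oner_eq0.
Qed.

Lemma irreducible_monomial_free F : mpoly_irreducible F ->
  monomial_free F \/ exists k c, c != 0 /\ F = c *: 'X_k.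
Proof.
move=> [F0 Fu Firr]; have [/forallP ?|/forallPn[k kF]] := boolP [forall k, var_ndvd k F].
  by left.
right; exists k; have [m mF|G FE] := @mpolyX_factor U_(k)%MM F.
  by rewrite lep1mP; move: kF; apply: contraNneq => mk; apply/hasP; exists m; rewrite ?mk.
have [|/mpoly_unitP[c c0 Gc]] := Firr _ _ FE.
  by rewrite (negPf (mpolyX_unit _)).
by exists c; split=> //; rewrite FE Gc mulrC mul_mpolyC.
Qed.

Lemma irreducible_homog_deg_gt0 d F : mpoly_irreducible F -> F \is d.-homog -> (0 < d)%N.
Proof.
move=> [F0 /negP Fu _] /dhomogP homF; rewrite lt0n; apply/eqP => d0; apply: Fu.
apply/mpoly_unitP; exists F@_0%MM.
  have := mlead_supp F0; rewrite mcoeff_msupp; congr (F@_ _ != 0); apply/eqP.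
  by rewrite -mdeg_eq0 (homF _ (mlead_supp F0)) d0.
apply/mpolyP => m; rewrite mcoeffC; have [->|m0] := eqVneq; first by rewrite mulr1.
rewrite mulr0; apply: memN_msupp_eq0; apply: contra m0 => /homF/eqP.
by rewrite /= d0 mdeg_eq0.
Qed.

(** Total degrees add up, so one factor of a polynomial of degree 1 is constant. *)
Lemma linear_form_irreducible F : F != 0 -> F \is 1.-homog -> mpoly_irreducible F.
Proof.
move=> F0 /[dup] homF /dhomogP hom.
have sF : msize F = 2 by rewrite -mlead_deg // (hom _ (mlead_supp F0)).
split=> //.
  by apply/mpoly_unitP => -[c c0 Fc]; move: sF; rewrite Fc msizeC c0.
move=> A B FE; have := F0; rewrite FE mulf_eq0 negb_or => /andP[A0 B0].
have uE (C : {mpoly K[n.+1]}) : C != 0 -> (msize C <= 1)%N -> C \is a GRing.unit.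
  move=> C0 /msize1_polyC CE; apply/mpoly_unitP; exists (C@_0%MM) => //.
  by apply: contra_neq C0 => c0; rewrite CE c0 mpolyC0.
move: sF; rewrite FE msizeM // => s.
have [/uE|lA] := leqP (msize A) 1; first by left; auto.
have aux (a b : nat) : (a + b).-1 = 2 -> (1 < a)%N -> (b <= 1)%N by lia.
by right; apply: uE => //; exact: aux s lA.
Qed.

End MonomialFactors.

(** * The standard Cremona transformation on forms *)

Section StandardCremona.

Variables (K : closedFieldType) (n : nat).
Hypothesis n_gt0 : (0 < n)%N.
Implicit Types (F G A B : {mpoly K[n.+1]}) (m u mu nu : 'X_{1..n.+1}).

Definition std_cremona : n.+1.-tuple {mpoly K[n.+1]} :=
  [tuple \prod_(l < n.+1 | l != k) 'X_l | k < n.+1].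

Local Notation sigma := std_cremona.

(** The exponent of the pull-back of [X^m] under the map whose k-th component is the
    product of the variables other than X_k. *)
Definition cremona_mnm m : 'X_{1..n.+1} := [multinom (mdeg m - m k)%N | k < n.+1].

Lemma mnm_le_mdeg m k : (m k <= mdeg m)%N.
Proof. by rewrite mdegE (bigD1 k) //= leq_addr. Qed.

Lemma mdeg_cremona_mnm m : mdeg (cremona_mnm m) = (n * mdeg m)%N.
Proof.
suff : (mdeg (cremona_mnm m) + mdeg m = n.+1 * mdeg m)%N by rewrite mulSn; lia.
rewrite [mdeg (cremona_mnm m)]mdegE [X in (_ + X)%N]mdegE -big_split /=.
rewrite (eq_bigr (fun=> mdeg m)) => [|k _]; first by rewrite sum_nat_const card_ord.
by rewrite mnmE subnK ?mnm_le_mdeg.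
Qed.

(** The total degree is multiplied by n, hence [mdeg m] and then every [m k] can be
    recovered. Therefore no cancellation occurs in the pull-back of a polynomial. *)
Lemma cremona_mnm_inj : injective cremona_mnm.
Proof.
move=> m u e; have d : mdeg m = mdeg u.
  have := congr1 (@mdeg _) e; rewrite !mdeg_cremona_mnm => /eqP.
  by rewrite eqn_pmul2l // => /eqP.
apply/mnmP => k; have /mnmP/(_ k) := e; rewrite !mnmE -d.
by have := mnm_le_mdeg m k; have := mnm_le_mdeg u k; rewrite -d; lia.
Qed.

Lemma prod_std_cremona m :
  \prod_(k < n.+1) (tnth sigma k) ^+ m k = 'X_[cremona_mnm m].
Proof.
rewrite mpolyXE_id.
transitivity (\prod_(k < n.+1) \prod_(l < n.+1)
    (if l != k then 'X_l ^+ m k else 1 : {mpoly K[n.+1]})).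
  apply: eq_bigr => k _; rewrite tnth_mktuple -prodrXl big_mkcond /=.
  by apply: eq_bigr => l _; case: ifP.
rewrite exchange_big /=; apply: eq_bigr => l _; rewrite -big_mkcond /= prodrXr.
congr (_ ^+ _); rewrite mnmE mdegE [in RHS](bigD1 l) //= addKn.
by apply: eq_bigl => k; rewrite eq_sym.
Qed.

Lemma comp_cremonaX m : 'X_[m] \mPo sigma = 'X_[cremona_mnm m].
Proof. by rewrite comp_mpolyX prod_std_cremona. Qed.

Lemma mcoeff_cremona F m : (F \mPo sigma)@_(cremona_mnm m) = F@_m.
Proof.
rewrite comp_mpolyEX [F in RHS]mpolyE !raddf_sum /=; apply: eq_bigr => u _.
rewrite comp_cremonaX !mcoeffZ !mcoeffX; congr (_ * _%:R).
by rewrite (inj_eq cremona_mnm_inj).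
Qed.

Lemma msupp_cremona F u : u \in msupp (F \mPo sigma) ->
  exists2 m, m \in msupp F & u = cremona_mnm m.
Proof.
rewrite comp_mpolyEX => /msupp_sum_le /flattenP[s /mapP[m]].
rewrite mem_filter /= => mF -> /msuppZ_le; rewrite comp_cremonaX msuppX inE => /eqP.
by exists m.
Qed.

Lemma comp_cremona_neq0 F : F != 0 -> F \mPo sigma != 0.
Proof.
move=> F0; have := mlead_supp F0; rewrite mcoeff_msupp -mcoeff_cremona.
by apply: contraNneq => ->; rewrite mcoeff0.
Qed.

Lemma homog_cremona d F : F \is d.-homog -> F \mPo sigma \is (n * d).-homog.
Proof.
move=> /dhomogP hom; apply/dhomogP => u /msupp_cremona[m /hom md ->].
by rewrite /= mdeg_cremona_mnm md.
Qed.

Lemma comp_homog_scale d F (c : {mpoly K[n.+1]}) (g : n.+1.-tuple {mpoly K[n.+1]}) :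
  F \is d.-homog -> F \mPo [tuple c * tnth g k | k < n.+1] = c ^+ d * (F \mPo g).
Proof.
move=> /dhomogP hom; rewrite !comp_mpolyEX mulr_sumr big_seq [RHS]big_seq.
apply: eq_bigr => m mF; rewrite -scalerAr; congr (_ *: _); rewrite !comp_mpolyX.
rewrite -(hom _ mF) /= mdegE -prodrXr -big_split /=; apply: eq_bigr => k _.
by rewrite tnth_mktuple exprMn.
Qed.

Definition all_vars : 'X_{1..n.+1} := [multinom 1%N | k < n.+1].

(** The standard Cremona transformation is an involution of the projective space:
    squaring it multiplies all coordinates by the same monomial. *)
Lemma std_cremonaK k : tnth sigma k \mPo sigma = 'X_[all_vars *+ n.-1] * 'X_k.
Proof.
rewrite tnth_mktuple rmorph_prod /= -mpolyXD.
have -> : \prod_(l < n.+1 | l != k) ('X_l \mPo sigma) =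
   \prod_(l < n.+1 | l != k) 'X_[cremona_mnm U_(l)].
  by apply: eq_bigr => l _; rewrite comp_cremonaX.
rewrite mprodXE; congr 'X_[_]; apply/mnmP => l.
rewrite mnm_sumE mnmDE mulmnE mnm1E mnmE mul1n.
rewrite (eq_bigr (fun i => (l != i) : nat)); last first.
  by move=> i _; rewrite mnmE mdeg1 mnm1E eq_sym; case: eqP.
have [<-|kl] := eqVneq k l.
  rewrite (eq_bigr (fun=> 1%N)) => [|i]; last by rewrite eq_sym => ->.
  by rewrite sum1_card cardC1 card_ord addn1 prednK.
rewrite addn0 (bigD1 l) 1?eq_sym //= eqxx add0n (eq_bigr (fun=> 1%N)); last first.
  by move=> i /andP[_]; rewrite eq_sym => ->.
have : (\sum_(i < n.+1 | i != k) 1)%N = n by rewrite sum1_card cardC1 card_ord.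
by rewrite (bigD1 l) 1?eq_sym //=; lia.
Qed.

Lemma comp_cremonaK d F : F \is d.-homog ->
  (F \mPo sigma) \mPo sigma = 'X_[all_vars *+ (n.-1 * d)] * F.
Proof.
move=> homF; rewrite comp_mpolyA.
have -> : [tuple tnth sigma i \mPo sigma | i < n.+1] =
   [tuple 'X_[all_vars *+ n.-1] * tnth [tuple 'X_i | i < n.+1] k | k < n.+1].
  by apply: eq_from_tnth => k; rewrite [LHS]tnth_mktuple std_cremonaK !tnth_mktuple.
rewrite (comp_homog_scale _ _ homF) comp_mpoly_id mpolyXn.
by congr ('X_[_] * _); apply/mnmP => k; rewrite !mulmnE mulnA.
Qed.

End StandardCremona.

(** * The proper transform under the standard transformation *)

Section ProperTransform.

Variables (K : closedFieldType) (n : nat).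
Hypothesis n_gt0 : (0 < n)%N.
Implicit Types (F G A B : {mpoly K[n.+1]}) (m u mu nu : 'X_{1..n.+1}).

Local Notation sigma := (std_cremona K n).

Definition vertex_mults F : 'X_{1..n.+1} :=
  [multinom multiplicity (delta_mx 0%R k) F | k < n.+1].

(** The multiplicity of F at a vertex is the least d - m_k over the monomials of F,
    which is also the exact power of X_k in the pull-back: the exceptional divisor over
    the vertex e_k is the coordinate hyperplane [X_k = 0] on the other side. *)
Lemma cremona_factor d F : F \is d.-homog -> monomial_free F ->
  exists G, F \mPo sigma = 'X_[vertex_mults F] * G /\ monomial_free G.
Proof.
move=> homF mfF; have F0 := monomial_free_neq0 mfF.
have hom := dhomogP _ _ _ homF.
have [mu [G [FG mfG]]] := factor_monomial (comp_cremona_neq0 n_gt0 F0).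
exists G; split=> //; suff -> : vertex_mults F = mu by [].
apply/mnmP => k; rewrite mnmE; have [le [m mF me]] := multiplicity_vertex k F0 homF.
set mk := multiplicity _ F in le me *.
apply/eqP; rewrite eqn_leq; apply/andP; split.
  have /hasP[u uG /eqP uk] := mfG k.
  have : (mu + u)%MM \in msupp (F \mPo sigma).
    by rewrite FG mem_msuppXM lem_addr addmC addmK.
  move=> /msupp_cremona[v vF /mnmP/(_ k)]; rewrite mnmDE uk addn0 mnmE.
  by move=> ->; have := le _ vF; have := hom _ vF; rewrite /= => ->; lia.
have : cremona_mnm m \in msupp (F \mPo sigma).
  by rewrite mcoeff_msupp mcoeff_cremona // -mcoeff_msupp.
rewrite FG mem_msuppXM => /andP[/mnm_lepP/(_ k)]; rewrite mnmE.
by have := hom _ mF; rewrite /= => ->; lia.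
Qed.

(** If the pull-back of A is a monomial then so is A, since [cremona_mnm] is injective;
    and A is not divisible by any variable. *)
Lemma unit_of_cremona A a A' : monomial_free A -> A \mPo sigma = 'X_[a] * A' ->
  A' \is a GRing.unit -> A \is a GRing.unit.
Proof.
move=> mfA AE /mpoly_unitP[c c0 A'c]; apply/mpoly_unitP.
have supp m : m \in msupp A -> cremona_mnm m = a.
  rewrite mcoeff_msupp -(mcoeff_cremona n_gt0) -mcoeff_msupp AE A'c mulrC mul_mpolyC.
  by rewrite msuppMCX // inE => /eqP.
have supp0 m : m \in msupp A -> m = 0%MM.
  move=> mA; apply/mnmP => k; rewrite mnm0E; have /hasP[u uA /eqP <-] := mfA k.
  by suff -> : m = u by []; apply: (cremona_mnm_inj n_gt0); rewrite !supp.
have A0 := monomial_free_neq0 mfA.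
exists A@_0%MM; first by rewrite -mcoeff_msupp -(supp0 _ (mlead_supp A0)) mlead_supp.
apply/mpolyP => m; rewrite mcoeffC; have [->|m0] := eqVneq; first by rewrite mulr1.
by rewrite mulr0; apply: memN_msupp_eq0; apply: contra m0 => /supp0 ->.
Qed.

Definition all_powers d : 'X_{1..n.+1} := (all_vars n *+ (n.-1 * d))%MM.

(** Pulling back twice gives F times a monomial, so G pulls back to a monomial times F.
    A factorization [G = A * B] then splits a monomial times F; as F is irreducible and
    variables are prime, the pull-back of A or of B is a monomial, and the corresponding
    factor of G is a unit. The relation between the two monomials will give the
    multiplicities of G at the vertices. *)
Lemma proper_transform d F :
  mpoly_irreducible F -> F \is d.-homog -> monomial_free F ->
  exists G nu,
   [/\ F \mPo sigma = 'X_[vertex_mults F] * G, G \mPo sigma = 'X_[nu] * F,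
      (cremona_mnm (vertex_mults F) + nu = all_powers d)%MM,
      mpoly_irreducible G & monomial_free G].
Proof.
move=> irrF homF mfF; have [G [FG mfG]] := cremona_factor homF mfF.
have F0 := monomial_free_neq0 mfF; have G0 := monomial_free_neq0 mfG.
have [nu [F' [GF' mfF']]] := factor_monomial (comp_cremona_neq0 n_gt0 G0).
have := comp_cremonaK n_gt0 homF; rewrite FG rmorphM /= comp_cremonaX GF' mulrA -mpolyXD.
move=> /(monomial_factor_unique mfF' mfF)[eX F'F]; rewrite {}F'F {mfF'} in GF' *.
exists G, nu; split=> //; have [_ Fu Firr] := irrF; split=> // [|A B GAB].
  apply: contra Fu => /mpoly_unitP[c c0 Gc].
  have : 'X_[nu] * F \is a GRing.unit.
    by rewrite -GF' Gc comp_mpolyC; apply/mpoly_unitP; exists c.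
  by rewrite unitrM => /andP[].
have mfAB k : var_ndvd k A && var_ndvd k B by rewrite -var_ndvdM -GAB.
have mfA k : var_ndvd k A by case/andP: (mfAB k).
have mfB k : var_ndvd k B by case/andP: (mfAB k).
have := GF'; rewrite GAB rmorphM /=.
move=> /(monomial_factor_split mfF)[a [b [A' [B' [EA EB /esym FE]]]]].
case: (Firr _ _ FE) => u; [left|right].
  exact: unit_of_cremona EA u.
exact: unit_of_cremona EB u.
Qed.

Lemma homog_proper_transform d F G mu : F \is d.-homog -> monomial_free G ->
  F \mPo sigma = 'X_[mu] * G ->
  G \is (n * d - mdeg mu).-homog /\ (mdeg mu <= n * d)%N.
Proof.
move=> homF mfG FG; have /dhomogP hom := homog_cremona n_gt0 homF.
have mulG u : u \in msupp G -> (mdeg mu + mdeg u = n * d)%N.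
  move=> uG; rewrite -mdegD; apply: hom.
  by rewrite FG mem_msuppXM lem_addr addmC addmK.
split; last by rewrite -(mulG _ (mlead_supp (monomial_free_neq0 mfG))) leq_addr.
by apply/dhomogP => u /mulG <-; rewrite addKn.
Qed.

Lemma vertex_mults_proper_transform d e F G nu :
  F \is d.-homog -> monomial_free F -> G \is e.-homog -> monomial_free G ->
  G \mPo sigma = 'X_[nu] * F -> vertex_mults G = nu.
Proof.
move=> homF mfF homG mfG GF; have [F' [GF' mfF']] := cremona_factor homG mfG.
by have [] := monomial_factor_unique mfF' mfF (etrans (esym GF') GF).
Qed.

Lemma multiplicity_scale d F (c : K) (y : 'rV[K]_n.+1) : F != 0 -> F \is d.-homog ->
  c != 0 -> multiplicity (c *: y) F = multiplicity y F.
Proof.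
move=> F0 homF; suff le e z : e != 0 -> (multiplicity (e *: z) F <= multiplicity z F)%N.
  move=> c0; apply/eqP; rewrite eqn_leq le //=.
  by rewrite -{1}[y](scalerK c0) le // invr_eq0.
move=> e0; pose g := [tuple e%:MP * tnth [tuple 'X_i | i < n.+1] k | k < n.+1]
  : n.+1.-tuple {mpoly K[n.+1]}.
have -> : e *: z = polymap g z.
  by apply/rowP => k; rewrite !mxE !tnth_mktuple mevalM mevalC mevalXU.
have gE : F \mPo g = F * (e ^+ d)%:MP.
  by rewrite (comp_homog_scale _ _ homF) comp_mpoly_id rmorphXn mulrC.
rewrite -(@multiplicity_mulr _ _ z F (e ^+ d)%:MP) ?mevalC ?expf_neq0 //.
by rewrite -gE; apply: multiplicity_comp => //; rewrite gE mulf_neq0 // mpolyC_eq0 expf_neq0.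
Qed.

Lemma polymap_cremona (y : 'rV[K]_n.+1) k :
  polymap sigma y 0 k = \prod_(l < n.+1 | l != k) y 0 l.
Proof.
rewrite mxE tnth_mktuple rmorph_prod /=.
by apply: eq_bigr => l _; rewrite mevalXU.
Qed.

Definition torus_point (y : 'rV[K]_n.+1) := forall k, y 0 k != 0.

Lemma torus_cremona y : torus_point y -> torus_point (polymap sigma y).
Proof.
by move=> y0 k; rewrite polymap_cremona; apply/prodf_neq0 => l _; exact: y0.
Qed.

Lemma polymap_cremonaK y :
  polymap sigma (polymap sigma y) = ((\prod_k y 0 k) ^+ n.-1) *: y.
Proof.
apply/rowP => k; rewrite -[LHS]mevalXU -comp_meval comp_mpolyU -comp_meval.
rewrite std_cremonaK // mevalM mevalXU mxE; congr (_ * _).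
rewrite mevalX -prodrXl; apply: eq_bigr => l _; congr (_ ^+ _).
by rewrite mulmnE mnmE mul1n.
Qed.

Lemma monomial_torus mu y : torus_point y -> ('X_[mu] : {mpoly K[n.+1]}).@[y 0] != 0.
Proof. by move=> y0; rewrite mevalX; apply/prodf_neq0 => k _; rewrite expf_neq0. Qed.

Lemma multiplicity_torus_le F G mu y : F != 0 -> G != 0 -> torus_point y ->
  F \mPo sigma = 'X_[mu] * G -> (multiplicity (polymap sigma y) F <= multiplicity y G)%N.
Proof.
move=> F0 G0 y0 FG; rewrite -(multiplicity_mulr G0 (monomial_torus mu y0)) mulrC -FG.
by apply: multiplicity_comp; rewrite ?comp_cremona_neq0.
Qed.

(** Semicontinuity of the multiplicity under the transformation holds in both
    directions, because its square fixes the points of the torus up to a scalar, and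
    monomials do not vanish there. *)
Lemma multiplicity_torus e F G mu nu y : F != 0 -> G != 0 -> G \is e.-homog ->
  torus_point y -> F \mPo sigma = 'X_[mu] * G -> G \mPo sigma = 'X_[nu] * F ->
  multiplicity (polymap sigma y) F = multiplicity y G.
Proof.
move=> F0 G0 homG y0 FG GF; apply/eqP; rewrite eqn_leq (multiplicity_torus_le _ _ _ FG) //=.
have := multiplicity_torus_le G0 F0 (torus_cremona y0) GF.
rewrite polymap_cremonaK (multiplicity_scale _ G0 homG) //.
by rewrite expf_neq0 //; apply/prodf_neq0 => k _; exact: y0.
Qed.

End ProperTransform.

(** * Linear changes of coordinates *)

Section LinearChange.

Variables (K : closedFieldType) (n : nat).
Implicit Types (F G A B : {mpoly K[n.+1]}) (M N : 'M[K]_n.+1) (x y : 'rV[K]_n.+1).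

Definition linear_subst M : n.+1.-tuple {mpoly K[n.+1]} :=
  [tuple \sum_l M l k *: 'X_l | k < n.+1].

Lemma polymap_linear M y : polymap (linear_subst M) y = y *m M.
Proof.
apply/rowP => k; rewrite !mxE tnth_mktuple raddf_sum /=.
by apply: eq_bigr => l _; rewrite mevalZ mevalXU mulrC.
Qed.

Lemma linear_substM M N F :
  (F \mPo linear_subst M) \mPo linear_subst N = F \mPo linear_subst (N *m M).
Proof.
rewrite comp_mpolyA; apply: comp_mpoly_eq => k; rewrite !tnth_mktuple raddf_sum /=.
under eq_bigr do rewrite comp_mpolyZ comp_mpolyU tnth_mktuple scaler_sumr.
rewrite exchange_big /=; apply: eq_bigr => l _; rewrite mxE scaler_suml.
by apply: eq_bigr => i _; rewrite scalerA mulrC.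
Qed.

Lemma linear_subst1 F : F \mPo linear_subst 1%:M = F.
Proof.
rewrite -[RHS]comp_mpoly_id; apply: comp_mpoly_eq => k; rewrite !tnth_mktuple.
rewrite (bigD1 k) //= mxE eqxx scale1r big1 ?addr0 // => l /negPf lk.
by rewrite mxE lk scale0r.
Qed.

Lemma linear_substK M F : M \in unitmx ->
  (F \mPo linear_subst M) \mPo linear_subst (invmx M) = F.
Proof. by move=> uM; rewrite linear_substM mulVmx // linear_subst1. Qed.

Lemma linear_substKV M F : M \in unitmx ->
  (F \mPo linear_subst (invmx M)) \mPo linear_subst M = F.
Proof. by move=> uM; rewrite linear_substM mulmxV // linear_subst1. Qed.

Lemma linear_subst_neq0 M F : M \in unitmx -> F != 0 -> F \mPo linear_subst M != 0.
Proof.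
by move=> uM; apply: contra_neq => e; rewrite -(linear_substK F uM) e comp_mpoly0.
Qed.

Lemma linear_subst_unit M F : M \in unitmx ->
  (F \mPo linear_subst M \is a GRing.unit) = (F \is a GRing.unit).
Proof.
move=> uM; apply/idP/idP => [u|]; last exact: rmorph_unit.
by rewrite -(linear_substK F uM); exact: rmorph_unit.
Qed.

Lemma linear_subst_irreducible M F : M \in unitmx ->
  mpoly_irreducible F -> mpoly_irreducible (F \mPo linear_subst M).
Proof.
move=> uM [F0 Fu Firr]; split; rewrite ?linear_subst_neq0 ?linear_subst_unit //.
move=> A B FAB; have uV : invmx M \in unitmx by rewrite unitmx_inv.
rewrite -(linear_subst_unit A uV) -(linear_subst_unit B uV); apply: Firr.
by rewrite -rmorphM -FAB /= linear_substK.
Qed.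

Lemma linear_subst_homog M d F : F \is d.-homog -> F \mPo linear_subst M \is d.-homog.
Proof.
move=> /dhomogP hom; rewrite comp_mpolyEX big_seq; apply: rpred_sum => m /hom <-.
apply: rpredZ; rewrite comp_mpolyX /= mdegE.
apply: (big_ind2 (fun (P : {mpoly K[n.+1]}) e => P \is e.-homog)) => [||i _].
- exact: dhomog1.
- by move=> P e Q f; exact: dhomogM.
rewrite -[X in X.-homog]mul1n; apply: dhomogMn; rewrite tnth_mktuple.
by apply: rpred_sum => l _; apply: rpredZ; rewrite dhomogX /= mdeg1.
Qed.

Lemma multiplicity_linear M F y : M \in unitmx -> F != 0 ->
  multiplicity y (F \mPo linear_subst M) = multiplicity (y *m M) F.
Proof.
move=> uM F0; have le N G z : N \in unitmx -> G != 0 ->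
    (multiplicity (z *m N) G <= multiplicity z (G \mPo linear_subst N))%N.
  by move=> uN G0; rewrite -polymap_linear multiplicity_comp ?linear_subst_neq0.
have uV : invmx M \in unitmx by rewrite unitmx_inv.
apply/eqP; rewrite eqn_leq le // andbT.
have := le _ _ (y *m M) uV (linear_subst_neq0 uM F0).
by rewrite mulmxK // linear_substK.
Qed.

End LinearChange.

(** * The Weyl group acting on the lattice *)

Section Lattice.

Variables (n s : nat).
Hypotheses (n_gt1 : (2 <= n)%N) (n_lt_s : (n.+1 <= s)%N).
Implicit Types (D : Pic s) (j k : 'I_s).

Definition base_sum D : int := \sum_(j < s | (j < n.+1)%N) D.2 j.

(** The reflection adds this integer to d and to the first n + 1 multiplicities; it is
    negative exactly when the Cremona transformation lowers the degree. *)
Definition cremona_shift D : int := (n%:Z - 1) * D.1 - base_sum D.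

Lemma PicMzE (D : Pic s) (z : int) : D *~ z = (D.1 *~ z, D.2 *~ z).
Proof. by rewrite [LHS]surjective_pairing (raddfMz fst) (raddfMz snd). Qed.

Lemma PicMnE (D : Pic s) r : D *+ r = (D.1 *+ r, D.2 *+ r).
Proof. by rewrite [LHS]surjective_pairing (raddfMn fst) (raddfMn snd). Qed.

Lemma PicMn2 D r j : (D *+ r).2 j = D.2 j *+ r.
Proof. by rewrite PicMnE ffunMnE. Qed.

Lemma PicB2 D D' j : (D - D').2 j = D.2 j - D'.2 j.
Proof. by rewrite !ffunE. Qed.

Lemma Pic_sumE (I : Type) (r : seq I) (P : pred I) (F : I -> Pic s) :
  \sum_(i <- r | P i) F i = (\sum_(i <- r | P i) (F i).1, \sum_(i <- r | P i) (F i).2).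
Proof. by rewrite [LHS]surjective_pairing (raddf_sum fst) (raddf_sum snd). Qed.

Lemma PicP D D' : D.1 = D'.1 -> (forall j, D.2 j = D'.2 j) -> D = D'.
Proof. by case: D D' => [d m] [d' m'] /= -> e; congr (_, _); apply/ffunP. Qed.

Lemma linear_extension1 h (e : 'I_s -> Pic s) D :
  (linear_extension h e D).1 = h.1 * D.1 - \sum_j (e j).1 * D.2 j.
Proof.
rewrite /linear_extension PicMzE Pic_sumE /= mulrzz; congr (_ - _).
by apply: eq_bigr => j _; rewrite PicMzE /= mulrzz.
Qed.

Lemma linear_extension2 h (e : 'I_s -> Pic s) D k :
  (linear_extension h e D).2 k = h.2 k * D.1 - \sum_j (e j).2 k * D.2 j.
Proof.
rewrite /linear_extension PicMzE Pic_sumE /= !ffunE sum_ffunE ffunMzE mulrzz.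
by congr (_ - _); apply: eq_bigr => j _; rewrite PicMzE /= ffunMzE mulrzz.
Qed.

Lemma E_snd j k : (E j).2 k = - (k == j)%:R :> int.
Proof. by rewrite ffunE. Qed.

Lemma sum_E_fst (P : pred 'I_s) : (\sum_(j < s | P j) E j).1 = 0.
Proof. by rewrite Pic_sumE /= big1. Qed.

Lemma sum_E_snd (P : pred 'I_s) k : (\sum_(j < s | P j) E j).2 k = - (P k)%:R.
Proof.
rewrite Pic_sumE /= sum_ffunE (eq_bigr (fun j => - (k == j)%:R)); last first.
  by move=> j _; rewrite ffunE.
rewrite sumrN; congr (- _); have [Pk|Pk] := boolP (P k).
  rewrite (bigD1 k) //= eqxx big1 ?addr0 // => j /andP[_].
  by rewrite eq_sym => /negPf ->.
by rewrite big1 // => j Pj; case: eqP => // e; rewrite e Pj in Pk.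
Qed.

Lemma cremonaE D : cremona n D =
  (D.1 + cremona_shift D,
   [ffun j => D.2 j + (if (j < n.+1)%N then cremona_shift D else 0)]).
Proof.
apply: PicP => [|k]; rewrite [RHS]/=.
  rewrite /cremona linear_extension1 /= !PicMnE /= sum_E_fst mul0rn subr0.
  rewrite (eq_bigr (fun j => if (j < n.+1)%N then D.2 j else 0)); last first.
    by move=> j _; case: ifP => _; rewrite /= ?mul0r // sum_E_fst subr0 mul1r.
  by rewrite -big_mkcond /= /cremona_shift -/(base_sum D) natz; ring.
rewrite /cremona linear_extension2 PicB2 !PicMn2 sum_E_snd !ffunE.
rewrite mul0rn add0r mulNrn opprK.
have -> : (k < n.+1)%N%:R *+ n.-1 = (if (k < n.+1)%N then n%:Z - 1 else 0) :> int.
  by case: ltnP => _; rewrite ?mul0rn //= natz; lia.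
rewrite (eq_bigr (fun j => if (k < n.+1)%N then
    (if (j < n.+1)%N then D.2 j else 0) - (k == j)%:R * D.2 j
    else - (k == j)%:R * D.2 j)); last first.
  move=> j _; have [jn|jn] := ltnP j n.+1; last first.
    rewrite E_snd; case: ltnP => kn; last by [].
    by rewrite sub0r mulNr.
  rewrite PicB2 sum_E_snd ffunE add0r opprK; have [kn|kn] := ltnP k n.+1.
    by rewrite andTb; case: eqP => _; rewrite ?mul0r ?mul1r ?subrr ?subr0.
  by case: eqP => e; [rewrite -e ltnNge kn in jn|rewrite oppr0].
have S : \sum_j (k == j)%:R * D.2 j = D.2 k.
  rewrite (bigD1 k) //= eqxx mul1r big1 ?addr0 // => j /negPf jk.
  by rewrite eq_sym jk mul0r.
case: ltnP => kn.
  rewrite big_split /= sumrN S -big_mkcond /= -/(base_sum D) /cremona_shift.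
  by ring.
rewrite (eq_bigr (fun j => - ((k == j)%:R * D.2 j))) => [|j _]; last by rewrite mulNr.
by rewrite sumrN S mul0r add0r opprK addr0.
Qed.

Lemma base_sum_const (c : int) : \sum_(j < s | (j < n.+1)%N) c = c * n.+1%:Z.
Proof.
rewrite (big_ord_narrow n_lt_s) sumr_const card_ord -mulr_natr.
by rewrite natz.
Qed.

Lemma base_sum_cremona D :
  base_sum (cremona n D) = base_sum D + cremona_shift D * n.+1%:Z.
Proof.
rewrite /base_sum -base_sum_const -big_split; apply: eq_bigr => j jn; rewrite [RHS]/=.
by rewrite cremonaE /= ffunE jn.
Qed.

Lemma cremona_shiftK D : cremona_shift (cremona n D) = - cremona_shift D.
Proof.
rewrite {1}/cremona_shift base_sum_cremona cremonaE /= /cremona_shift.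
have -> : Posz n.+1 = n%:Z + 1 by rewrite -addn1.
ring.
Qed.

Lemma cremonaK D : cremona n (cremona n D) = D.
Proof.
rewrite cremonaE cremona_shiftK cremonaE; apply: PicP => [|k] /=; first by rewrite addrK.
by rewrite !ffunE; case: ifP => _; rewrite ?addrK ?addr0.
Qed.

Lemma cremonaMn D r : cremona n (D *+ r) = cremona n D *+ r.
Proof.
have sM : cremona_shift (D *+ r) = cremona_shift D *+ r.
  rewrite /cremona_shift /base_sum PicMnE /= mulrnAr mulrnBl; congr (_ - _).
  by rewrite -sumrMnl; apply: eq_bigr => j _; rewrite ffunMnE.
rewrite !cremonaE sM; apply: PicP => [|k]; first by rewrite !PicMnE /= -mulrnDl.
by rewrite PicMn2 /= !ffunE PicMn2; case: ifP => _; rewrite -?mulrnDl ?addr0.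
Qed.

Lemma pairing_cremona D : pairing n (cremona n D) (cremona n D) = pairing n D D.
Proof.
rewrite /pairing; set t := cremona_shift D.
have -> : (cremona n D).1 = D.1 + t by rewrite cremonaE.
rewrite (eq_bigr (fun j => D.2 j * D.2 j +
   (if (j < n.+1)%N then D.2 j * (2 * t) + t * t else 0))); last first.
  move=> j _; rewrite cremonaE /= ffunE -/t.
  by case: ifP => _; rewrite ?addr0 //; ring.
rewrite big_split /= -big_mkcond /= big_split /= base_sum_const -mulr_suml.
rewrite -/(base_sum D).
have -> : base_sum D = (n%:Z - 1) * D.1 - t by rewrite /t /cremona_shift; ring.
have -> : Posz n.+1 = n%:Z + 1 by rewrite -addn1.
ring.
Qed.

Lemma adeg_cremona D : adeg n (cremona n D) = adeg n D.
Proof.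
rewrite !adegE // cremonaE [_.1]/= [_.2]/=; set t := cremona_shift D.
rewrite (eq_bigr (fun j => D.2 j + (if (j < n.+1)%N then t else 0))); last first.
  by move=> j _; rewrite ffunE.
by rewrite big_split /= -big_mkcond base_sum_const; ring.
Qed.

Definition perm_class (sg : 'S_s) D : Pic s := (D.1, [ffun j => D.2 (sg j)]).

Lemma exchangeE j k D : exchange j k D = perm_class (tperm j k) D.
Proof.
apply: PicP => [|l]; rewrite [RHS]/=.
  by rewrite /exchange linear_extension1 /= mul1r big1 ?subr0 // => i _; rewrite mul0r.
rewrite /exchange linear_extension2 !ffunE mul0r add0r (bigD1 (tperm j k l)) //= big1 ?addr0.
  by rewrite ffunE tpermK eqxx mulN1r opprK.
move=> i il; rewrite ffunE; case: eqP => [e|]; last by rewrite oppr0 mul0r.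
by rewrite e tpermK eqxx in il.
Qed.

Lemma perm_class1 D : perm_class 1%g D = D.
Proof. by apply: PicP => //= j; rewrite ffunE perm1. Qed.

Lemma perm_classM sg tau D :
  perm_class (sg * tau)%g D = perm_class sg (perm_class tau D).
Proof. by apply: PicP => //= j; rewrite !ffunE permM. Qed.

Lemma perm_classMn sg D r : perm_class sg (D *+ r) = perm_class sg D *+ r.
Proof.
by apply: PicP => [|j]; rewrite ?PicMn2 /= ?PicMnE // !ffunE ffunMnE.
Qed.

Lemma pairing_perm sg D : pairing n (perm_class sg D) (perm_class sg D) = pairing n D D.
Proof.
rewrite /pairing /= [in RHS](reindex_inj (@perm_inj _ sg)) /=.
by congr (_ - _); apply: eq_bigr => j _; rewrite !ffunE.
Qed.

Lemma adeg_perm sg D : adeg n (perm_class sg D) = adeg n D.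
Proof.
rewrite !adegE //= [in RHS](reindex_inj (@perm_inj _ sg)) /=.
by congr (_ - _); apply: eq_bigr => j _; rewrite !ffunE.
Qed.

Lemma weyl_inverse w : weyl_group n w ->
  exists w', [/\ weyl_group n w', cancel w w' & cancel w' (w : Pic s -> Pic s)].
Proof.
elim=> {w} [|T ST|w1 w2 _ [v1 [W1 K1 L1]] _ [v2 [W2 K2 L2]]|w w' W _ K L].
- by exists id; split=> //; exact: weyl_id.
- exists T; suff TK : involutive T by split=> //; exact: weyl_simple.
  move=> D; case: ST => [j k _|]; last exact: cremonaK.
  by rewrite !exchangeE -perm_classM tperm2 perm_class1.
- exists (v2 \o v1); split; first exact: weyl_comp.
    by move=> D /=; rewrite K1 K2.
  by move=> D /=; rewrite L2 L1.
- by exists w.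
Qed.

(** The generators are involutions, so a property that they preserve is also preserved
    by inverses. *)
Lemma weyl_invariant (P : Pic s -> Prop) :
  (forall sg D, P D -> P (perm_class sg D)) -> (forall D, P D -> P (cremona n D)) ->
  forall w, weyl_group n w -> forall D, P D <-> P (w D).
Proof.
move=> Pperm Pcrem; have simpleP T : simple_reflection n T -> forall D, P D -> P (T D).
  by move=> ST D PD; case: ST => [j k _|]; [rewrite exchangeE|]; auto.
move=> w; elim=> {w} [//|T ST D|w w' _ IH _ IH' D|w w' _ IH K L D].
- split; first exact: simpleP.
  have TK : T (T D) = D.
    case: ST => [j k _|]; last exact: cremonaK.
    by rewrite !exchangeE -perm_classM tperm2 perm_class1.
  by move=> /(simpleP _ ST); rewrite TK.
- by rewrite IH' IH.
- by rewrite -{1}[D]L -IH.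
Qed.

Lemma weyl_numeric w D : weyl_group n w ->
  pairing n (w D) (w D) = pairing n D D /\ adeg n (w D) = adeg n D.
Proof.
move=> W; pose P D' := pairing n D' D' = pairing n D D /\ adeg n D' = adeg n D.
have Pperm sg D' : P D' -> P (perm_class sg D').
  by rewrite /P pairing_perm adeg_perm.
have Pcrem D' : P D' -> P (cremona n D').
  by rewrite /P pairing_cremona adeg_cremona.
exact: (weyl_invariant Pperm Pcrem W D).1.
Qed.

(** Adjacent transpositions generate the symmetric group: [(j k+1)] is the conjugate of
    [(j k)] by [(k k+1)]. *)
Lemma weyl_perm (sg : 'S_s) : exists2 w, weyl_group n w & w =1 perm_class sg.
Proof.
pose Q sg := exists2 w, weyl_group n w & w =1 perm_class sg.
have QM sg1 sg2 : Q sg1 -> Q sg2 -> Q (sg1 * sg2)%g.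
  move=> [w1 W1 e1] [w2 W2 e2]; exists (w1 \o w2); first exact: weyl_comp.
  by move=> D /=; rewrite e1 e2 perm_classM.
have Q1 : Q 1%g by exists id; [exact: weyl_id|move=> D; rewrite perm_class1].
have Qadj j k : k = j.+1 :> nat -> Q (tperm j k).
  move=> e; exists (exchange j k); last by move=> D; rewrite exchangeE.
  by apply: weyl_simple; exact: simple_exchange.
have Qt d : forall j k : 'I_s, (k = j + d :> nat)%N -> Q (tperm j k).
  elim: d => [|d IH] j k e.
    have -> : k = j by apply: val_inj; rewrite /= e addn0.
    by rewrite tperm1.
  have js : (j + d < s)%N by have := ltn_ord k; rewrite e addnS; exact: ltn_trans.
  pose l := Ordinal js; have lk : k = l.+1 :> nat by rewrite e addnS.
  have [d0|d0] := posnP d.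
    by apply: Qadj; rewrite e d0 addn1.
  have jl : j != l by apply/eqP => /(congr1 val) /=; lia.
  have jk : j != k by apply/eqP => /(congr1 val) /=; lia.
  have -> : tperm j k = (tperm l k * tperm j l * tperm l k)%g.
    have := tpermJ j l (tperm l k); rewrite /conjg tpermV tpermL mulgA.
    by rewrite tpermD 1?eq_sym // => ->.
  exact: (QM _ _ (QM _ _ (Qadj _ _ lk) (IH j l erefl)) (Qadj _ _ lk)).
have [ts -> _] := prod_tpermP sg; elim: ts => [|t ts IH]; first by rewrite big_nil.
rewrite big_cons; apply: QM => //; case/orP: (leq_total t.1 t.2) => le.
  by apply: (Qt (t.2 - t.1)%N); rewrite subnKC.
by rewrite tpermC; apply: (Qt (t.1 - t.2)%N); rewrite subnKC.
Qed.

Lemma weyl_divisor_weyl i w D : weyl_group n w -> weyl_divisor n i D -> weyl_divisor n i (w D).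
Proof.
move=> W [w' [J [W' cJ ->]]]; exists (w \o w'), J; split=> //; exact: weyl_comp.
Qed.

Lemma weyl_divisor_perm i sg D : weyl_divisor n i (perm_class sg D) -> weyl_divisor n i D.
Proof.
have [w W e] := weyl_perm sg^-1; move=> /(weyl_divisor_weyl W).
by rewrite e -perm_classM mulVg perm_class1.
Qed.

Lemma weyl_divisor_cremona i D : weyl_divisor n i (cremona n D) -> weyl_divisor n i D.
Proof.
have W : weyl_group n (@cremona n s) by apply: weyl_simple; exact: simple_cremona.
by move=> /(weyl_divisor_weyl W); rewrite cremonaK.
Qed.

Lemma hyperplane_throughE (J : {set 'I_s}) :
  hyperplane_through J = (1, [ffun j => (j \in J)%:R]).
Proof.
apply: PicP => [|j]; first by rewrite /= sum_E_fst subr0.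
by rewrite PicB2 sum_E_snd !ffunE opprK add0r.
Qed.

Lemma perm_hyperplane sg (J : {set 'I_s}) :
  perm_class sg (hyperplane_through J) = hyperplane_through (sg @^-1: J).
Proof.
by rewrite !hyperplane_throughE; apply: PicP => //= j; rewrite !ffunE inE.
Qed.

(** Both sets are initial segments of an enumeration of the indices (the set, then its
    complement); match the two enumerations. *)
Lemma perm_of_card (J J' : {set 'I_s}) : #|J| = #|J'| ->
  exists sg : 'S_s, sg @^-1: J = J'.
Proof.
move=> cJ; pose f (A : {set 'I_s}) := enum A ++ enum (~: A).
have pf A : perm_eq (f A) (enum 'I_s).
  apply: uniq_perm; rewrite ?enum_uniq //.
    rewrite cat_uniq !enum_uniq andbT /=; apply/hasPn => x.
    by rewrite !mem_enum inE.
  by move=> x; rewrite mem_cat !mem_enum inE orbN.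
have sf A : size (f A) = s by rewrite (perm_size (pf A)) size_enum_ord.
have fu A : uniq (f A) by rewrite (perm_uniq (pf A)) enum_uniq.
have fm A x : x \in f A by rewrite (perm_mem (pf A)) mem_enum.
have szE : size (f J) = size (f J') by rewrite !sf.
pose g x := nth x (f J) (index x (f J')).
have idx x A : (index x (f A) < #|A|)%N = (x \in A).
  rewrite /f index_cat mem_enum; case: ifP => xA.
    by rewrite cardE index_mem mem_enum.
  by rewrite -cardE ltnNge leq_addr.
have gi : injective g.
  move=> x y; have ix : (index x (f J') < size (f J))%N by rewrite szE index_mem fm.
  have iy : (index y (f J') < size (f J))%N by rewrite szE index_mem fm.
  rewrite /g (set_nth_default y x ix) => /eqP; rewrite nth_uniq // => /eqP e.
  by rewrite -[x](nth_index x (fm J' x)) e nth_index.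
exists (perm gi); apply/setP => x; rewrite inE permE -(idx _ J) -(idx x J') cJ /g.
by rewrite index_uniq ?fu // szE index_mem fm.
Qed.

End Lattice.

(** * Divisors on blow-ups at two Cremona-related configurations *)

Section CremonaPairs.

Variables (K : closedFieldType) (n s : nat).
Hypotheses (n_gt1 : (2 <= n)%N) (n_lt_s : (n.+1 <= s)%N).
Implicit Types (p q : config K n s) (M : 'M[K]_n.+1) (Y : hypersurface K n).
Implicit Types (D : Pic s).

Local Notation sigma := (std_cremona K n).
Local Notation base := (widen_ord n_lt_s).

Let n_gt0 : (0 < n)%N. Proof. exact: ltnW. Qed.

Lemma base_indexP (j : 'I_s) : (j < n.+1)%N -> exists k : 'I_n.+1, j = base k.
Proof. by move=> jn; exists (Ordinal jn); exact: val_inj. Qed.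

(** Equality of points of projective space, for nonzero vectors. *)
Definition proportional_to (x y : 'rV[K]_n.+1) := exists2 a, a != 0 & x = a *: y.

Definition in_frame M p :=
  (forall k, row (base k) p = row k M) /\
  (forall j : 'I_s, (n < j)%N ->
     exists2 x, torus_point x & proportional_to (row j p) (x *m M)).

(** In the coordinates given by the rows of M, the first n + 1 points of p and q are the
    vertices, and the others correspond to each other under the standard Cremona
    transformation. Scalars are left free, which makes the relation symmetric. *)
Definition cremona_related M p q :=
  [/\ M \in unitmx,
     forall k, row (base k) p = row k M, forall k, row (base k) q = row k M &
     forall j : 'I_s, (n < j)%N -> exists2 x, torus_point x &
       proportional_to (row j p) (x *m M) /\
       proportional_to (row j q) (polymap sigma x *m M)].

Lemma cremona_related_in_frame M p q : cremona_related M p q -> in_frame M p.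
Proof.
by move=> [uM pM qM rel]; split=> // j /rel[x x0 [? _]]; exists x.
Qed.

Lemma cremona_related_sym M p q : cremona_related M p q -> cremona_related M q p.
Proof.
move=> [uM pM qM rel]; split=> // j /rel[x x0 [[a a0 pj] qj]].
exists (polymap sigma x); first exact: torus_cremona.
split=> //; rewrite polymap_cremonaK //; set c := _ ^+ _.
have c0 : c != 0 by rewrite expf_neq0 //; apply/prodf_neq0 => k _; exact: x0.
exists (a / c); first by rewrite mulf_neq0 ?invr_eq0.
by rewrite pj -scalemxAl scalerA divfK.
Qed.

Lemma multiplicity_proportional d F (x y : 'rV[K]_n.+1) : F != 0 -> F \is d.-homog ->
  proportional_to x y -> multiplicity x F = multiplicity y F.
Proof. by move=> F0 homF [a a0 ->]; exact: multiplicity_scale homF a0. Qed.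

Lemma row_delta (M : 'M[K]_n.+1) k : row k M = delta_mx 0 k *m M.
Proof. by rewrite rowE. Qed.

Lemma class_mult_base M p Y k : M \in unitmx -> in_frame M p ->
  (divisor_class p (ProperTransform s Y)).2 (base k) =
  (vertex_mults (hyp_eqn Y \mPo linear_subst M) k)%:Z.
Proof.
case: Y => d F homF [F0 Fu irrF] uM [pM _] /=.
by rewrite ffunE /= pM row_delta mnmE multiplicity_linear.
Qed.

Lemma base_sum_class M p Y : M \in unitmx -> in_frame M p ->
  base_sum n (divisor_class p (ProperTransform s Y)) =
  (mdeg (vertex_mults (hyp_eqn Y \mPo linear_subst M)))%:Z.
Proof.
move=> uM fM; rewrite /base_sum (big_ord_narrow n_lt_s) mdegE.
rewrite (big_morph Posz PoszD (erefl _)); apply: eq_bigr => k _.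
exact: class_mult_base.
Qed.

Lemma class_mult_rest M p Y (j : 'I_s) x : M \in unitmx ->
  proportional_to (row j p) (x *m M) ->
  (divisor_class p (ProperTransform s Y)).2 j =
  (multiplicity x (hyp_eqn Y \mPo linear_subst M))%:Z.
Proof.
case: Y => d F homF [F0 Fu irrF] uM px /=.
by rewrite ffunE /= (multiplicity_proportional F0 homF px) multiplicity_linear.
Qed.

(** A prime divisor other than a coordinate hyperplane is mapped to its proper
    transform, of degree [n d - sum mu] and multiplicities [(n - 1) d - sum_(l <> k)
    mu_l] at the vertices, where mu lists the multiplicities of the given divisor there;
    elsewhere multiplicities do not change. *)
Lemma class_proper_transform M p q Y : cremona_related M p q ->
  monomial_free (hyp_eqn Y \mPo linear_subst M) ->
  exists Y', divisor_class q (ProperTransform s Y') =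
             cremona n (divisor_class p (ProperTransform s Y)).
Proof.
move=> rel mfF; have [uM pM qM relj] := rel.
have fp := cremona_related_in_frame rel.
have fq := cremona_related_in_frame (cremona_related_sym rel).
have uV : invmx M \in unitmx by rewrite unitmx_inv.
set F := _ \mPo _ in mfF; set d := hyp_deg Y.
have homF : F \is d.-homog by apply: linear_subst_homog; exact: hyp_homog.
have irrF : mpoly_irreducible F by apply: linear_subst_irreducible => //; exact: hyp_irr.
have [G [nu [FG GF mu_nu irrG mfG]]] := proper_transform n_gt0 irrF homF mfF.
have [homG le_mu] := homog_proper_transform n_gt0 homF mfG FG.
have vG := vertex_mults_proper_transform n_gt0 homF mfF homG mfG GF.
have F0 := monomial_free_neq0 mfF; have G0 := monomial_free_neq0 mfG.
pose Y' := Hypersurface (linear_subst_homog (invmx M) homG) (linear_subst_irreducible uV irrG).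
have Y'G : hyp_eqn Y' \mPo linear_subst M = G by rewrite /= linear_substKV.
exists Y'; set C := divisor_class p _.
have tE : cremona_shift n C = (n%:Z - 1) * d%:Z - (mdeg (vertex_mults F))%:Z.
  by rewrite /cremona_shift (base_sum_class _ uM fp).
rewrite (cremonaE n_gt1 n_lt_s); apply: PicP => [|j]; first by rewrite /= tE -/d; lia.
rewrite [RHS]ffunE; case: ltnP => jn.
  have [k ->] := base_indexP jn; rewrite (class_mult_base _ _ uM fq).
  rewrite (class_mult_base _ _ uM fp) -/F Y'G vG tE.
  have /mnmP/(_ k) := mu_nu; rewrite mnmDE !mnmE mulmnE mnmE mul1n => e.
  have nE : (n%:Z - 1) * d%:Z = (n.-1 * d)%N%:Z.
    by rewrite PoszM; congr (_ * _); move: n_gt0; lia.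
  have le_k := mnm_le_mdeg (vertex_mults F) k; rewrite mnmE in le_k.
  by rewrite nE -e; lia.
have [x x0 [px qx]] := relj _ jn.
rewrite (class_mult_rest _ uM qx) (class_mult_rest _ uM px) -/F Y'G addr0.
congr Posz; apply/esym; rewrite -(multiplicity_torus n_gt0 G0 F0 homF x0 GF FG).
by [].
Qed.

(** The Cremona transformation contracts the hyperplane opposite to the k-th vertex to
    that vertex, so its class is the reflection of the exceptional class. *)
Lemma class_coordinate_hyperplane M p Y k c : M \in unitmx -> in_frame M p ->
  c != 0 -> hyp_eqn Y \mPo linear_subst M = c *: 'X_k ->
  divisor_class p (ProperTransform s Y) = cremona n (E (base k)).
Proof.
move=> uM fM c0 FE; have [pM prest] := fM.
have vE l : vertex_mults (c *: 'X_k) l = (l != k).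
  have X0 : c *: 'X_k != 0 :> {mpoly K[n.+1]} by rewrite -msupp_eq0 msuppMCX.
  have homX : c *: 'X_k \is [in K[n.+1], 1.-homog] by rewrite rpredZ // dhomogX /= mdeg1.
  have [_ [m]] := multiplicity_vertex l X0 homX.
  rewrite msuppMCX // inE => /eqP ->; rewrite mnm1E mnmE eq_sym.
  by set mu := multiplicity _ _; case: eqP => _; lia.
have dE : hyp_deg Y = 1%N.
  have := linear_subst_homog M (hyp_homog Y); rewrite FE => /dhomogP/(_ U_(k)%MM).
  by rewrite msuppMCX // mem_head => /(_ isT) <-; rewrite /= mdeg1.
have tE : cremona_shift n (E (base k)) = 1.
  rewrite /cremona_shift /base_sum /= mulr0 (bigD1 (base k)) /= ?ltn_ord // ffunE eqxx.
  by rewrite big1 ?addr0 // => j /andP[_ /negPf jk]; rewrite ffunE jk.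
rewrite (cremonaE n_gt1 n_lt_s); apply: PicP => [|j]; first by rewrite /= dE tE.
rewrite [RHS]ffunE tE E_snd; case: ltnP => jn.
  have [l ->] := base_indexP jn; rewrite (class_mult_base _ _ uM fM) FE vE.
  by rewrite -(inj_eq val_inj) /= -(inj_eq val_inj) /=; case: eqP.
have [x x0 px] := prest _ jn; rewrite (class_mult_rest _ uM px) FE.
rewrite multiplicity_eq0; last by rewrite mevalZ mevalXU mulf_neq0.
rewrite addr0; case: eqP => // e; move: jn; rewrite e /= ltnNge.
by rewrite -ltnS ltn_ord.
Qed.

Lemma coordinate_hyperplane_exists M k : M \in unitmx -> exists Y : hypersurface K n,
  hyp_eqn Y \mPo linear_subst M = 'X_k.
Proof.
move=> uM; have uV : invmx M \in unitmx by rewrite unitmx_inv.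
have homX : ('X_k : {mpoly K[n.+1]}) \is 1.-homog by rewrite dhomogX /= mdeg1.
have irrX : mpoly_irreducible ('X_k : {mpoly K[n.+1]}).
  by apply: linear_form_irreducible => //; rewrite -msupp_eq0 msuppX.
exists (Hypersurface (linear_subst_homog (invmx M) homX) (linear_subst_irreducible uV irrX)).
by rewrite /= linear_substKV.
Qed.

(** Prime divisors correspond bijectively under the Cremona transformation, coordinate
    hyperplanes being exchanged with the exceptional divisors over the vertices. *)
Lemma prime_divisor_cremona M p q (P : prime_divisor K n s) : cremona_related M p q ->
  exists P', divisor_class q P' = cremona n (divisor_class p P).
Proof.
move=> rel; have [uM pM qM relj] := rel; case: P => [j|Y].
  have [jn|jn] := ltnP j n.+1.
    have [k ->] := base_indexP jn; have [Y YE] := coordinate_hyperplane_exists k uM.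
    exists (ProperTransform _ Y); apply: (class_coordinate_hyperplane uM _ (oner_neq0 K)).
      exact: cremona_related_in_frame (cremona_related_sym rel).
    by rewrite scale1r.
  exists (Exceptional _ _ j); rewrite (cremonaE n_gt1 n_lt_s).
  have -> : cremona_shift n (E j) = 0.
    rewrite /cremona_shift /base_sum /= mulr0 big1 ?subr0 // => l ln.
    by rewrite ffunE; case: eqP => // e; rewrite -e ltnNge -ltnS ln in jn.
  apply: PicP => [|l]; first by rewrite /= addr0.
  by rewrite [RHS]ffunE if_same addr0.
have [|[k [c [c0 FE]]]] := irreducible_monomial_free
  (linear_subst_irreducible uM (hyp_irr Y)).
  move=> mfF; have [Y' e] := class_proper_transform rel mfF.
  by exists (ProperTransform _ Y').
exists (Exceptional _ _ (base k)).
rewrite (class_coordinate_hyperplane uM (cremona_related_in_frame rel) c0 FE).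
by rewrite (cremonaK n_gt1 n_lt_s).
Qed.

Lemma effective_irreducible_cremona M p q D : cremona_related M p q ->
  effective_irreducible p D -> effective_irreducible q (cremona n D).
Proof.
move=> rel [P [r [r0 ->]]]; have [P' e] := prime_divisor_cremona P rel.
by exists P', r; rewrite (cremonaMn n_gt1 n_lt_s) e.
Qed.

Lemma effective_irreducible_perm (sg : 'S_s) p D : effective_irreducible p D ->
  effective_irreducible (row_perm sg p) (perm_class sg D).
Proof.
move=> [P [r [r0 ->]]]; have [P' e] : exists P' : prime_divisor K n s,
    divisor_class (row_perm sg p) P' = perm_class sg (divisor_class p P).
  case: P => [j|Y].
    exists (Exceptional _ _ (sg^-1%g j)); apply: PicP => //= k; rewrite !ffunE.
    by rewrite -(inj_eq (@perm_inj _ sg)) permKV.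
  exists (ProperTransform _ Y); apply: PicP => //= k; rewrite !ffunE.
  by have -> : row k (row_perm sg p) = row (sg k) p by apply/rowP => l; rewrite !mxE.
by exists P', r; rewrite perm_classMn e.
Qed.

Lemma degree_of_effective p D : effective_irreducible p D ->
  (exists j r, (0 < r)%N /\ D = E j *+ r) \/
  (0 < D.1 /\ forall j, 0 <= D.2 j <= D.1).
Proof.
move=> [[j|Y] [r [r0 ->]]]; [by left; exists j, r|right].
have d0 := irreducible_homog_deg_gt0 (hyp_irr Y) (hyp_homog Y).
split; first by rewrite PicMnE /= pmulrn_lgt0.
move=> j; rewrite PicMn2 PicMnE /= ffunE mulrn_wge0 //= lerMn2r.
have [F0 _ _] := hyp_irr Y.
by rewrite lez_nat (multiplicity_le_deg _ F0 (hyp_homog Y)) orbT.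
Qed.

End CremonaPairs.

(** * General configurations *)

Section NonvanishingPoint.

Variables (K : closedFieldType) (N : nat).
Implicit Types (G : {mpoly K[N]}) (m u : 'X_{1..N}).

(** The number whose digits in base b are the exponents: substituting [T ^ (b ^ k)] for
    X_k keeps apart the monomials with exponents less than b. *)
Definition kronecker_exp b m := (\sum_(k < N) m k * b ^ k)%N.

Lemma base_digits_inj b (N' : nat) (f g : nat -> nat) :
  (forall k, f k < b)%N -> (forall k, g k < b)%N ->
  (\sum_(k < N') f k * b ^ k = \sum_(k < N') g k * b ^ k)%N ->
  forall k, (k < N')%N -> f k = g k.
Proof.
elim: N' f g => [//|N' IH] f g fb gb.
have b0 : (0 < b)%N by exact: leq_ltn_trans (fb 0%N).
have split_sum (h : nat -> nat) : (\sum_(k < N'.+1) h k * b ^ k =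
    h 0%N + (\sum_(k < N') h k.+1 * b ^ k) * b)%N.
  rewrite big_ord_recl expn0 muln1 big_distrl; congr addn.
  by apply: eq_bigr => k _; rewrite /= /bump /= add1n expnSr mulnA.
rewrite !split_sum => e; have e0 : f 0%N = g 0%N.
  have := congr1 (modn^~ b) e.
  by rewrite ![(_ + _ * b)%N]addnC !modnMDl !modn_small.
move: e; rewrite e0 => /addnI/eqP; rewrite eqn_pmul2r // => /eqP e.
by case=> [//|k] kN; exact: IH (fun k => fb k.+1) (fun k => gb k.+1) e k kN.
Qed.

Lemma kronecker_exp_inj b m u : (forall k, m k < b)%N -> (forall k, u k < b)%N ->
  kronecker_exp b m = kronecker_exp b u -> m = u.
Proof.
move=> mb ub e; apply/mnmP => k; have b0 : (0 < b)%N := leq_ltn_trans (leq0n _) (mb k).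
(* Exponents extended by 0 to all natural numbers. *)
pose digit (w : 'X_{1..N}) i := oapp w 0%N (insub i : option 'I_N).
have digitE w (i : 'I_N) : digit w i = w i by rewrite /digit valK.
have digit_lt (w : 'X_{1..N}) : (forall i, w i < b)%N -> forall i, (digit w i < b)%N.
  by move=> wb i; rewrite /digit; case: insub.
rewrite -!digitE; apply: (base_digits_inj (digit_lt _ mb) (digit_lt _ ub) _ (ltn_ord k)).
rewrite (eq_bigr (fun i : 'I_N => m i * b ^ i)%N) => [|i _]; last by rewrite digitE.
by rewrite -/(kronecker_exp b m) e; apply: eq_bigr => i _; rewrite digitE.
Qed.

Definition kronecker b G : {poly K} := mmap (@polyC K) (fun k : 'I_N => 'X^(b ^ k)) G.

Lemma kroneckerE b G :
  kronecker b G = \sum_(m <- msupp G) G@_m *: 'X^(kronecker_exp b m).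
Proof.
apply: eq_bigr => m _; rewrite mul_polyC; congr (_ *: _).
rewrite /mmap1 /kronecker_exp -prodrXr; apply: eq_bigr => k _.
by rewrite -exprM mulnC.
Qed.

(** Kronecker substitution reduces the claim to one variable, where a nonzero polynomial
    over an algebraically closed field has a non-root. *)
Lemma nonvanishing_point G : G != 0 -> exists v : 'I_N -> K, G.@[v] != 0.
Proof.
move=> G0; pose b := msize G; have small m k : m \in msupp G -> (m k < b)%N.
  by move=> /msize_mdeg_lt; apply: leq_ltn_trans; rewrite mdegE (bigD1 k) //= leq_addr.
have : kronecker b G != 0.
  have lG := mlead_supp G0; apply: contraTneq lG => /(congr1 (coefp (kronecker_exp b (mlead G)))).
  rewrite kroneckerE raddf_sum /= (bigD1_seq (mlead G)) ?mlead_supp ?msupp_uniq //=.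
  rewrite coefZ coefXn eqxx mulr1 coef0 big_seq_cond big1 ?addr0 => [|m /andP[mG mm]].
    by move/eqP; rewrite mleadc_eq0 (negPf G0).
  rewrite coefZ coefXn; case: eqP => [e|]; last by rewrite mulr0.
  case/eqP: mm; apply: esym; apply: (kronecker_exp_inj (b := b)) => // k; apply: small => //.
  exact: mlead_supp.
move=> /closed_nonrootP[t]; rewrite /root => nt; exists (fun k => t ^+ (b ^ k)).
suff -> : G.@[fun k : 'I_N => t ^+ (b ^ k)] = (kronecker b G).[t] by [].
rewrite kroneckerE mevalE horner_sum; apply: eq_bigr => m _.
rewrite hornerZ hornerXn /kronecker_exp -prodrXr; congr (_ * _).
by apply: eq_bigr => k _; rewrite -exprM mulnC.
Qed.

End NonvanishingPoint.

Section Generality.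

Variables (K : closedFieldType) (n s : nat).
Hypotheses (n_gt1 : (2 <= n)%N) (n_lt_s : (n.+1 <= s)%N).
Implicit Types (p q : config K n s) (Q : config K n s -> Prop).
Implicit Types (G : {mpoly K[s * n.+1]}) (R : comNzRingType).

Local Notation base := (widen_ord n_lt_s).
Local Notation sigma := (std_cremona K n).

Let n_gt0 : (0 < n)%N. Proof. exact: ltnW. Qed.

(** The matrix of indeterminates. Applying a construction that is natural in the ring to
    it yields the polynomial, or polynomials, computing the construction on all
    configurations. *)
Definition generic_config : 'M[{mpoly K[s * n.+1]}]_(s, n.+1) :=
  \matrix_(j, k) 'X_(mxvec_index j k).

Local Notation eval p := (meval (mxvec p 0)).

Lemma map_generic_config p : map_mx (eval p) generic_config = p.
Proof. by apply/matrixP => j k; rewrite !mxE mevalXU mxvecE. Qed.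

Lemma general_mono Q Q' : (forall p, homogeneous_coordinates p -> Q p -> Q' p) ->
  for_general_points Q -> for_general_points Q'.
Proof. by move=> QQ' [G G0 GQ]; exists G => // p hp /(GQ _ hp); exact: QQ'. Qed.

Lemma general_all Q : (forall p, Q p) -> for_general_points Q.
Proof. by move=> allQ; exists 1 => //; exact: oner_neq0. Qed.

Definition natural_function (phi : forall R, 'M[R]_(s, n.+1) -> R) :=
  forall R (S : comNzRingType) (f : {rmorphism R -> S}) (P : 'M_(s, n.+1)),
    f (phi R P) = phi S (map_mx f P).

Definition natural_map (phi : forall R, 'M[R]_(s, n.+1) -> 'M[R]_(s, n.+1)) :=
  forall R (S : comNzRingType) (f : {rmorphism R -> S}) (P : 'M_(s, n.+1)),
    map_mx f (phi R P) = phi S (map_mx f P).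

Lemma general_neq0 phi p0 : natural_function phi -> phi K p0 != 0 ->
  for_general_points (fun p => phi K p != 0).
Proof.
move=> nat_phi phi0; exists (phi _ generic_config) => [|p _].
  apply: contra_neq phi0 => e; rewrite -[p0]map_generic_config.
  by rewrite -[LHS](nat_phi _ _ (eval p0)) e rmorph0.
suff -> : phi K p = (eval p) (phi _ generic_config) by [].
by rewrite (nat_phi _ _ (eval p)) map_generic_config.
Qed.

(** The open set for [Q o phi] is cut out by the pull-back of the polynomial for Q,
    which is nonzero because phi is dominant: it reaches every configuration where uval
    does not vanish. *)
Lemma general_pullback phi uval Q : natural_map phi -> natural_function uval ->
  (forall q, uval K q != 0 -> exists2 p, uval K p != 0 & phi K p = q) ->
  (exists q, uval K q != 0) ->
  for_general_points Q ->
  for_general_points (fun p => uval K p != 0 /\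
                       (homogeneous_coordinates (phi K p) -> Q (phi K p))).
Proof.
move=> nat_phi nat_u onto [q0 uq0] [G G0 GQ].
pose u := uval _ generic_config.
have uE p : (eval p) u = uval K p.
  by rewrite /u (nat_u _ _ (eval p)) map_generic_config.
pose G' := G \mPo [tuple mxvec (phi _ generic_config) 0 k | k < s * n.+1].
have G'E p : (eval p) G' = (eval (phi K p)) G.
  rewrite comp_mpoly_meval; apply: meval_eq => k; rewrite tnth_mktuple.
  have -> : phi K p = map_mx (eval p) (phi _ generic_config).
    by rewrite nat_phi map_generic_config.
  by rewrite -map_mxvec mxE.
have u0 : u != 0.
  by apply: contra_neq uq0 => u0; rewrite -uE u0 meval0.
exists (u * G') => [|p hp].
  have /nonvanishing_point[v] : u * G != 0 by rewrite mulf_neq0.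
  pose q : config K n s := vec_mx (\row_k v k).
  have -> : (u * G).@[v] = eval q (u * G).
    by apply: meval_eq => k; rewrite vec_mxK mxE.
  rewrite mevalM mulf_eq0 negb_or uE => /andP[/onto[p up <-] Gp].
  apply: contraTneq Gp => e; have := congr1 (eval p) e.
  by rewrite mevalM meval0 uE G'E => /eqP; rewrite mulf_eq0 (negPf up) /= => ->.
rewrite /nonvanishing mevalM mulf_eq0 negb_or uE G'E => /andP[up Gp].
by split=> // hq; exact: GQ.
Qed.

Lemma general_perm (sg : 'S_s) Q : for_general_points Q ->
  for_general_points (fun p => Q (row_perm sg p)).
Proof.
move=> gQ; have := @general_pullback (fun R => @row_perm R s n.+1 sg) (fun R _ => 1) Q.
case=> [R S f P|R S f P|q _||//|G G0 GQ].
- by rewrite map_row_perm.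
- exact: rmorph1.
- exists (row_perm sg^-1 q); first exact: oner_neq0.
  by rewrite -row_permM mulgV row_perm1.
- by exists 0; exact: oner_neq0.
exists G => // p hp Gp; have [_] := GQ p hp Gp; apply=> j.
have -> : row j (row_perm sg p) = row (sg j) p by apply/rowP => l; rewrite !mxE.
exact: hp.
Qed.

Section Frames.

Variable R : comNzRingType.
Implicit Types (P : 'M[R]_(s, n.+1)).

Definition frame_mx P : 'M[R]_n.+1 := \matrix_(k, l) P (base k) l.

(** The coordinates of the j-th point in the frame of the first n + 1 points, multiplied
    by the determinant of the frame so that they are polynomial. *)
Definition frame_coord P j : 'rV[R]_n.+1 := row j P *m \adj (frame_mx P).

Definition frame_val P : R :=
  \det (frame_mx P) * \prod_(j < s | (n < j)%N) \prod_k frame_coord P j 0 k.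

Definition cremona_config P : 'M[R]_(s, n.+1) :=
  \matrix_(j, l) if (j < n.+1)%N then P j l
    else ((\row_k \prod_(i < n.+1 | i != k) frame_coord P j 0 i) *m frame_mx P) 0 l.

End Frames.

Lemma map_frame_mx (R S : comNzRingType) (f : {rmorphism R -> S}) (P : 'M_(s, n.+1)) :
  map_mx f (frame_mx P) = frame_mx (map_mx f P).
Proof. by apply/matrixP => k l; rewrite !mxE. Qed.

Lemma map_frame_coord (R S : comNzRingType) (f : {rmorphism R -> S}) (P : 'M_(s, n.+1)) j k :
  f (frame_coord P j 0 k) = frame_coord (map_mx f P) j 0 k.
Proof.
transitivity (map_mx f (frame_coord P j) 0 k); first by rewrite [RHS]mxE.
by rewrite /frame_coord map_mxM map_mx_adj map_frame_mx map_row.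
Qed.

Lemma frame_val_natural : natural_function (@frame_val).
Proof.
move=> R S f P; rewrite /frame_val rmorphM rmorph_prod -map_frame_mx det_map_mx.
congr (_ * _); apply: eq_bigr => j _; rewrite rmorph_prod.
by apply: eq_bigr => k _; rewrite map_frame_coord.
Qed.

Lemma cremona_config_natural : natural_map (@cremona_config).
Proof.
move=> R S f P; apply/matrixP => j l; rewrite [LHS]mxE [X in f X]mxE [RHS]mxE.
case: ifP => _; first by rewrite mxE.
set r : 'rV[R]_n.+1 := \row_k _.
transitivity (map_mx f (r *m frame_mx P) 0 l); first by rewrite [RHS]mxE.
rewrite map_mxM map_frame_mx; congr ((_ *m _) 0 l); apply/rowP => k.
rewrite [LHS]mxE [X in f X]mxE [RHS]mxE rmorph_prod.
by apply: eq_bigr => i _; rewrite map_frame_coord.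
Qed.

Lemma frame_valP p : reflect
  (\det (frame_mx p) != 0 /\ forall j : 'I_s, (n < j)%N -> torus_point (frame_coord p j))
  (frame_val p != 0).
Proof.
rewrite mulf_eq0 negb_or; apply: (iffP andP) => -[-> Hj]; split=> //.
  by move=> j jn k; have /prodf_neq0/(_ j jn)/prodf_neq0 := Hj; exact.
by apply/prodf_neq0 => j jn; apply/prodf_neq0 => k _; exact: Hj.
Qed.

Lemma frame_coordK p j :
  frame_coord p j *m frame_mx p = \det (frame_mx p) *: row j p.
Proof. by rewrite -mulmxA mul_adj_mx mul_mx_scalar. Qed.

Lemma row_frame p k : row (base k) p = row k (frame_mx p).
Proof. by apply/rowP => l; rewrite !mxE. Qed.

Lemma frame_unit p : frame_val p != 0 -> frame_mx p \in unitmx.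
Proof. by move=> /frame_valP[d _]; rewrite unitmxE unitfE. Qed.

Lemma row_proportional p j : frame_val p != 0 ->
  proportional_to (row j p) (frame_coord p j *m frame_mx p).
Proof.
move=> /frame_valP[d _]; exists (\det (frame_mx p))^-1; first by rewrite invr_eq0.
by rewrite frame_coordK scalerA mulVf // scale1r.
Qed.

Lemma in_frame_general p : frame_val p != 0 -> in_frame n_lt_s (frame_mx p) p.
Proof.
move=> up; split=> [k|j jn]; first exact: row_frame.
exists (frame_coord p j); last exact: row_proportional.
by have /frame_valP[_] := up; apply.
Qed.

Lemma row_cremona_config p (j : 'I_s) : (n < j)%N ->
  row j (cremona_config p) = polymap sigma (frame_coord p j) *m frame_mx p.
Proof.
move=> jn; apply/rowP => l; rewrite mxE [LHS]mxE ltnNge jn /=.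
by congr ((_ *m _) 0 l); apply/rowP => k; rewrite polymap_cremona mxE.
Qed.

Lemma frame_mx_cremona p : frame_mx (cremona_config p) = frame_mx p.
Proof. by apply/matrixP => k l; rewrite !mxE /= ltn_ord. Qed.

Lemma cremona_config_related p : frame_val p != 0 ->
  cremona_related n_lt_s (frame_mx p) p (cremona_config p).
Proof.
move=> up; split=> [|k|k|j jn]; rewrite ?frame_unit ?row_frame ?frame_mx_cremona //.
exists (frame_coord p j); first by have /frame_valP[_] := up; apply.
split; first exact: row_proportional.
by exists 1; rewrite ?oner_neq0 // scale1r row_cremona_config.
Qed.

Lemma homogeneous_cremona_config p : frame_val p != 0 ->
  homogeneous_coordinates (cremona_config p).
Proof.
move=> up j; have uA := frame_unit up.
have neq0 (x : 'rV[K]_n.+1) : x != 0 -> x *m frame_mx p != 0.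
  by apply: contra_neq => e; rewrite -[x](mulmxK uA) e mul0mx.
have [jn|jn] := ltnP j n.+1.
  have [k ->] := base_indexP n_lt_s jn; rewrite row_frame frame_mx_cremona rowE neq0 //.
  by apply/eqP => /rowP/(_ k); rewrite !mxE !eqxx => /eqP; rewrite oner_eq0.
rewrite row_cremona_config // neq0 //; apply/eqP => /rowP/(_ 0) /eqP.
have /frame_valP[_ /(_ j jn) x0] := up.
by rewrite [X in _ == X]mxE (negPf (torus_cremona x0 0)).
Qed.

Lemma root_exists (a : K) m : (0 < m)%N -> exists c, c ^+ m = a.
Proof.
move=> m0; have [c ce] := @solve_monicpoly K m (fun i => if i == 0%N then a else 0) m0.
exists c; rewrite ce; case: m m0 {ce} => // m _; rewrite big_ord_recl /= mulr1.
by rewrite big1 ?addr0 // => i _; rewrite mul0r.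
Qed.

(** A point with frame coordinates y is reached from one with coordinates [c / y_k]: the
    products of n of these are [c ^ n / prod_(i <> k) y_i], which is y_k when [c ^ n =
    prod_k y_k]. *)
Lemma cremona_config_onto q : frame_val q != 0 ->
  exists2 p : config K n s, frame_val p != 0 & cremona_config p = q.
Proof.
move=> uq; have uA := frame_unit uq; have /frame_valP[d0 qtorus] := uq.
set A := frame_mx q in uA d0; pose y j := (\det A)^-1 *: frame_coord q j.
have y0 (j : 'I_s) : (n < j)%N -> torus_point (y j).
  by move=> jn k; rewrite mxE mulf_neq0 ?invr_eq0 //; exact: qtorus.
have yA j : y j *m A = row j q.
  by rewrite -scalemxAl frame_coordK scalerA mulVf // scale1r.
have [c cE] : exists c : 'I_s -> K, forall j, c j ^+ n = \prod_k y j 0 k.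
  have H (j : 'I_s) := root_exists (\prod_k y j 0 k) n_gt0.
  by exists (fun j => sval (constructive_indefinite_description _ (H j))) => j;
    case: constructive_indefinite_description.
(* The transform of x j is y j, not only up to a scalar. *)
pose x j : 'rV[K]_n.+1 := \row_k (c j / y j 0 k).
pose p : config K n s := \matrix_(j, l) if (j < n.+1)%N then q j l
   else ((\det A)^-1 *: (x j *m A)) 0 l.
have pA : frame_mx p = A by apply/matrixP => k l; rewrite !mxE /= ltn_ord.
have px (j : 'I_s) : (n < j)%N -> frame_coord p j = x j.
  move=> jn; rewrite /frame_coord pA.
  have -> : row j p = (\det A)^-1 *: (x j *m A).
    by apply/rowP => l; rewrite mxE [LHS]mxE ltnNge jn.
  by rewrite -scalemxAl -mulmxA mul_mx_adj mul_mx_scalar scalerA mulVf // scale1r.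
have c0 (j : 'I_s) : (n < j)%N -> c j != 0.
  move=> jn; apply/eqP => cj; have := cE j; rewrite cj expr0n gtn_eqF // => /esym/eqP.
  by apply/negP; apply/prodf_neq0 => k _; exact: y0.
exists p.
  apply/frame_valP; rewrite pA; split=> // j jn k; rewrite px // mxE.
  by rewrite mulf_neq0 ?invr_eq0 ?c0 //; exact: y0.
apply/row_matrixP => j; have [jn|jn] := ltnP j n.+1.
  by apply/rowP => l; rewrite !mxE jn.
rewrite row_cremona_config // pA px // -yA; congr (_ *m _); apply/rowP => k.
rewrite polymap_cremona (eq_bigr (fun l => c j * (y j 0 l)^-1)) => [|l _]; last by rewrite mxE.
rewrite big_split /= prodr_const cardC1 card_ord cE (bigD1 k) //= prodfV mulfK //.
by apply/prodf_neq0 => l _; exact: y0.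
Qed.

Definition standard_config (t : K) : config K n s :=
  \matrix_(j, l) if (j < n.+1)%N then (j == l :> nat)%:R
                 else if (l == ord_max) then t else 1.

Lemma frame_mx_standard t : frame_mx (standard_config t) = 1%:M.
Proof. by apply/matrixP => k l; rewrite !mxE /= ltn_ord. Qed.

Lemma frame_coord_standard t (j : 'I_s) k : (n < j)%N ->
  frame_coord (standard_config t) j 0 k = if k == ord_max then t else 1.
Proof.
move=> jn; rewrite /frame_coord frame_mx_standard.
have -> : \adj (1%:M : 'M[K]_n.+1) = 1%:M.
  by rewrite -[LHS]mulmx1 mul_adj_mx det1.
by rewrite mulmx1 !mxE ltnNge jn.
Qed.

Lemma frame_val_standard t : t != 0 -> frame_val (standard_config t) != 0.
Proof.
move=> t0; apply/frame_valP; rewrite frame_mx_standard det1 oner_neq0; split=> // j jn k.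
by rewrite frame_coord_standard //; case: ifP => _; rewrite ?oner_neq0.
Qed.

Lemma general_cremona Q : for_general_points Q ->
  for_general_points (fun p =>
    cremona_related n_lt_s (frame_mx p) p (cremona_config p) /\ Q (cremona_config p)).
Proof.
move=> gQ; have := general_pullback cremona_config_natural frame_val_natural
  cremona_config_onto (ex_intro _ (standard_config 1) (frame_val_standard (oner_neq0 K))) gQ.
apply: general_mono => p _ [up Qp]; split; first exact: cremona_config_related.
exact/Qp/homogeneous_cremona_config.
Qed.

End Generality.

(** * Noether's inequality *)

Section Noether.

Variables (n s : nat).
Hypotheses (n_gt1 : (2 <= n)%N) (n_lt_s : (n.+1 <= s)%N).
Implicit Types (D : Pic s) (j k : 'I_s) (i : int).

Local Notation base := (widen_ord n_lt_s).

(** Let mu be the (n+1)-st multiplicity. Summing [m_j (m_j - mu) <= d (m_j - mu)] for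
    the first n + 1 indices and [m_j (m_j - mu) <= 0] for the others gives [d * base_sum
    >= (n - 1) d^2 + mu (2 + i) - i]. If the Cremona transformation did not lower the
    degree, then [mu (2 + i) <= i], which is absurd for i = -1 and otherwise gives mu =
    0, so that at most n multiplicities are nonzero; for these the sum of [(d - m_j)^2]
    is [-3 d^2 + 2 d (2 + i) - i], which is negative for d >= 2. *)
Lemma noether_inequality i D : i \in [:: -1; 0; 1] -> 2 <= D.1 ->
  (forall j, 0 <= D.2 j <= D.1) -> (forall j k, (j <= k)%N -> D.2 k <= D.2 j) ->
  pairing n D D = i -> adeg n D = 2 + i -> cremona_shift n D < 0.
Proof.
move=> i_range d2 m_range sortedD; rewrite adegE // /pairing /cremona_shift => sq lin.
set d := D.1 in d2 m_range sq lin *; set S := base_sum n D; rewrite ltNge; apply/negP => le_S.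
pose last := base ord_max; pose mu := D.2 last.
have mu0 : 0 <= mu by have /andP[] := m_range last.
have low j : (n <= j)%N -> D.2 j <= mu by move=> nj; exact: sortedD.
have high j : (j < n.+1)%N -> mu <= D.2 j by move=> jn; exact: sortedD.
have n1E : Posz n.+1 = n%:Z + 1 by rewrite -addn1.
rewrite n1E in lin.
have le1 : \sum_j D.2 j * D.2 j - mu * \sum_j D.2 j <= d * (S - mu * (n%:Z + 1)).
  rewrite -n1E -(base_sum_const n_lt_s) /S /base_sum -sumrB mulr_sumr mulr_sumr -sumrB.
  rewrite [X in _ <= X]big_mkcond; apply: ler_sum => j _.
  have /andP[m0 md] := m_range j; case: ltnP => jn; last by have := low j (ltnW jn); nia.
  by have := high j jn; nia.
set q := \sum_j D.2 j * D.2 j in sq le1; set l := \sum_j D.2 j in lin le1.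
have qE : q = (n%:Z - 1) * (d * d) - i by lia.
have lE : l = (n%:Z + 1) * d - 2 - i by lia.
have mu_i : mu * (2 + i) <= i.
  have : d * S <= d * ((n%:Z - 1) * d) by apply: ler_wpM2l; lia.
  by rewrite qE lE in le1; nia.
have [i0 muE] : 0 <= i /\ mu = 0.
  by move: i_range; rewrite !inE => /or3P[] /eqP ?; subst i; split; nia.
have zero j : (n <= j)%N -> D.2 j = 0.
  by move=> nj; have := low j nj; have /andP[] := m_range j; lia.
have : 0 <= \sum_(j < s | (j < n)%N) (d - D.2 j) * (d - D.2 j).
  by apply: sumr_ge0 => j _; rewrite -expr2 sqr_ge0.
have cN : \sum_(j < s | (j < n)%N) d * d = n%:Z * (d * d).
  by rewrite (big_ord_narrow (ltnW n_lt_s)) sumr_const card_ord -mulr_natl natz.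
rewrite (eq_bigr (fun j => d * d + (D.2 j * D.2 j - 2 * d * D.2 j))) => [|j _]; last by ring.
rewrite big_split /= cN [X in _ + X]big_mkcond /=.
rewrite (eq_bigr (fun j => D.2 j * D.2 j - 2 * d * D.2 j)) => [|j _]; last first.
  by case: ltnP => // /zero ->; ring.
rewrite sumrB -mulr_sumr -/q -/l qE lE.
by move: i_range; rewrite !inE => /or3P[] /eqP ?; subst i; nia.
Qed.

Lemma exists_sorting D : exists sg : 'S_s,
  forall j k, (j <= k)%N -> (perm_class sg D).2 k <= (perm_class sg D).2 j.
Proof.
pose r (j k : 'I_s) := D.2 k <= D.2 j.
have r_total : total r by move=> j k; exact: le_total.
have r_trans : transitive r by move=> j k l jk kl; exact: le_trans kl jk.
pose e := sort r (enum 'I_s).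
have se : size e = s by rewrite size_sort size_enum_ord.
have ue : uniq e by rewrite sort_uniq enum_uniq.
pose f (j : 'I_s) := nth j e j.
have js (j : 'I_s) : (j < size e)%N by rewrite se ltn_ord.
have f_inj : injective f.
  move=> j k; rewrite /f (set_nth_default k j (js j)) => /eqP.
  by rewrite nth_uniq ?js // => /eqP/val_inj.
exists (perm f_inj) => j k jk; rewrite !ffunE !permE /f (set_nth_default k j (js j)).
apply: (sorted_leq_nth r_trans _ k (sort_sorted r_total _)); rewrite ?inE ?js //.
by move=> x; rewrite /r lexx.
Qed.

Lemma weyl_divisor_degree1 i D : D.1 = 1 -> (forall j, 0 <= D.2 j <= D.1) ->
  adeg n D = 2 + i -> weyl_divisor n i D.
Proof.
move=> d1 m_range; rewrite adegE // d1 mulr1 => lin.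
pose J := [set j | D.2 j == 1].
have DJ : D = hyperplane_through J.
  rewrite hyperplane_throughE; apply: PicP => [//|j]; rewrite [RHS]ffunE inE.
  by have := m_range j; rewrite d1; case: eqP => /=; lia.
exists id, J; split; [exact: weyl_id| |exact: DJ].
move: lin; set q := \sum_j _ => lin; suff -> : #|J|%:Z = q by lia.
rewrite /q DJ hyperplane_throughE /= -sum1_card big_mkcond /= (big_morph Posz PoszD (erefl _)).
by apply: eq_bigr => j _; rewrite ffunE; case: (j \in J).
Qed.

(** The reflection of [E b], for a base point b, is a hyperplane through the other n
    base points. *)
Lemma weyl_divisor_exceptional j : weyl_divisor n (-1) (E j : Pic s).
Proof.
pose b := base ord0; apply: (weyl_divisor_perm n_gt1 n_lt_s (sg := tperm b j)).
have -> : perm_class (tperm b j) (E j) = E b.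
  apply: PicP => //= k; rewrite !ffunE -{2}[j](tpermL b j).
  by rewrite (inj_eq (@perm_inj _ _)).
apply: (weyl_divisor_cremona n_gt1 n_lt_s).
have tE : cremona_shift n (E b) = 1.
  rewrite /cremona_shift /base_sum /= mulr0 (bigD1 b) //= ffunE eqxx.
  by rewrite big1 ?addr0 // => k /andP[_ /negPf kb]; rewrite ffunE kb.
have numeric := weyl_numeric n_gt1 n_lt_s (E b) (weyl_simple (simple_cremona n s)).
apply: weyl_divisor_degree1.
- by rewrite (cremonaE n_gt1 n_lt_s) tE.
- move=> k; rewrite (cremonaE n_gt1 n_lt_s) tE [_.1]/= [_.2]/= !ffunE.
  by case: eqP => [->|_] //=; case: ifP.
rewrite numeric.2 adegE //= mulr0 (bigD1 b) //= ffunE eqxx big1 ?addr0 // => k /negPf kb.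
by rewrite ffunE kb.
Qed.

(** The square of [r E_j] is [- r^2], which leaves only r = 1 and i = -1. *)
Lemma exceptional_multiple i j r : i \in [:: -1; 0; 1] -> (0 < r)%N ->
  pairing n (E j *+ r : Pic s) (E j *+ r) = i -> weyl_divisor n i (E j *+ r : Pic s).
Proof.
move=> i_range r0; rewrite /pairing.
have -> : (E j *+ r).1 = 0 by rewrite PicMnE /= mul0rn.
rewrite mul0r mulr0 sub0r (bigD1 j) //= big1 ?addr0 => [|k /negPf kj]; last first.
  by rewrite PicMn2 E_snd kj oppr0 mul0rn mul0r.
rewrite PicMn2 E_snd eqxx mulNrn natz => e.
have [r1 i1] : r = 1%N /\ i = -1.
  by move: i_range; rewrite !inE => /or3P[] /eqP ?; subst i; split; nia.
by rewrite r1 mulr1n i1; exact: weyl_divisor_exceptional.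
Qed.

End Noether.

(** * Divisorial classes at general points *)

Section Main.

Variables (K : closedFieldType) (n s : nat).
Hypotheses (n_gt1 : (2 <= n)%N) (n_lt_s : (n.+1 <= s)%N).
Implicit Types (p q : config K n s) (D : Pic s) (i : int).

Local Notation base := (widen_ord n_lt_s).

Definition generally_effective D :=
  for_general_points (fun p : config K n s => effective_irreducible p D).

Lemma generally_effective_perm sg D :
  generally_effective D -> generally_effective (perm_class sg D).
Proof.
move=> /(general_perm sg^-1%g); apply: general_mono => p _.
by move=> /(effective_irreducible_perm sg); rewrite -row_permM mulgV row_perm1.
Qed.

Lemma generally_effective_cremona D :
  generally_effective D -> generally_effective (cremona n D).
Proof.
move=> /(general_cremona n_gt1 n_lt_s); apply: general_mono => p _ [rel].
apply: effective_irreducible_cremona => //; exact: cremona_related_sym rel.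
Qed.

(** The hyperplane where the frame coordinates of index at least r add up to zero. *)
Lemma hyperplane_effective r p : (r <= n)%N -> frame_val n_lt_s p != 0 ->
  (forall j : 'I_s, (n < j)%N -> \sum_(k < n.+1 | (r <= k)%N) frame_coord n_lt_s p j 0 k != 0) ->
  effective_irreducible p (hyperplane_through [set j : 'I_s | (j < r)%N]).
Proof.
move=> rn up Lp; pose L : {mpoly K[n.+1]} := \sum_(k < n.+1 | (r <= k)%N) 'X_k.
have uA := frame_unit up; have uV : invmx (frame_mx n_lt_s p) \in unitmx by rewrite unitmx_inv.
have homL : L \is 1.-homog by apply: rpred_sum => k _; rewrite dhomogX /= mdeg1.
have coefL k : L@_(U_(k)) = (r <= k)%N%:R.
  rewrite raddf_sum /=; case: leqP => rk.
    rewrite (bigD1 k) //= mcoeffXU eqxx big1 ?addr0 // => l /andP[_ /negPf lk].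
    by rewrite mcoeffXU lk.
  rewrite big1 // => l rl; rewrite mcoeffXU; case: eqP => // lk.
  by rewrite lk leqNgt rk in rl.
have L0 : L != 0.
  apply/eqP => /(congr1 (mcoeff U_(ord_max))); rewrite coefL /= rn mcoeff0 => /eqP.
  by rewrite oner_eq0.
have suppL m : m \in msupp L -> exists2 k : 'I_n.+1, (r <= k)%N & m = U_(k)%MM.
  move=> mL; have /eqP/mdeg1P[k /eqP mk] := dhomogP _ _ _ homL _ mL.
  by exists k => //; move: mL; rewrite mk mcoeff_msupp coefL; case: leqP; rewrite ?eqxx.
have irrL := linear_form_irreducible L0 homL.
pose Y := Hypersurface (linear_subst_homog (invmx (frame_mx n_lt_s p)) homL)
                       (linear_subst_irreducible uV irrL).
have YE : hyp_eqn Y \mPo linear_subst (frame_mx n_lt_s p) = L by rewrite /= linear_substKV.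
have fp := in_frame_general up.
exists (ProperTransform _ Y), 1%N; split=> //; rewrite mulr1n hyperplane_throughE.
apply: PicP => [//|j]; rewrite [LHS]ffunE inE; case: (ltnP j n.+1) => jn.
  have [k ->] := base_indexP n_lt_s jn; rewrite (class_mult_base _ _ uA fp) YE mnmE.
  have [le [m mL]] := multiplicity_vertex k L0 homL.
  have [l rl ->] := suppL _ mL; rewrite mnm1E; case: leqP => rk.
    have := le U_(k)%MM; rewrite mcoeff_msupp coefL rk oner_neq0 mnm1E eqxx => /(_ isT).
    by set mk := multiplicity _ _ => /=; lia.
  have -> : (l == k) = false by apply/negP => /eqP lk; rewrite lk leqNgt rk in rl.
  by rewrite add0n => ->.
rewrite (class_mult_rest _ uA (row_proportional j up)) YE.
rewrite multiplicity_eq0; first by rewrite ltnNge (leq_trans rn (ltnW jn)).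
rewrite raddf_sum /= (eq_bigr (fun k => frame_coord n_lt_s p j 0 k)) ?Lp // => k _.
by rewrite mevalXU.
Qed.

Definition hyperplane_val r (R : comNzRingType) (P : 'M[R]_(s, n.+1)) : R :=
  frame_val n_lt_s P *
  \prod_(j < s | (n < j)%N) \sum_(k < n.+1 | (r <= k)%N) frame_coord n_lt_s P j 0 k.

Lemma hyperplane_val_natural r : natural_function (hyperplane_val r).
Proof.
move=> R S f P; rewrite /hyperplane_val rmorphM rmorph_prod frame_val_natural.
congr (_ * _); apply: eq_bigr => j _; rewrite rmorph_sum.
by apply: eq_bigr => k _; rewrite map_frame_coord.
Qed.

(** After a permutation J consists of the first r points. That the hyperplane of
    [hyperplane_effective] avoids the points outside the frame is an open condition; it
    holds for the points with frame coordinates (1, ..., 1, t) as soon as t and t + (n -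
    r) are nonzero, which can be achieved in every characteristic. *)
Lemma generally_effective_hyperplane (J : {set 'I_s}) : (#|J| <= n)%N ->
  generally_effective (hyperplane_through J).
Proof.
set r := #|J| => rn; pose J0 := [set j : 'I_s | (j < r)%N].
have cJ0 : #|J0| = #|J|.
  rewrite -/r -sum1_card; under eq_bigl do rewrite inE.
  by rewrite (big_ord_narrow (leq_trans rn (ltnW n_lt_s))) sum1_card card_ord.
have [sg <-] := perm_of_card cJ0; rewrite -perm_hyperplane.
apply: generally_effective_perm.
pose c : K := (n - r)%:R.
(* A non-root t of this polynomial has t and t + c nonzero. *)
have [t] : exists t, ~~ root ('X * ('X + c%:P)) t.
  apply/closed_nonrootP; rewrite mulf_neq0 ?polyX_eq0 //.
  by rewrite -size_poly_eq0 size_XaddC.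
rewrite rootM negb_or /root hornerX hornerD hornerX hornerC => /andP[t0 tc].
have val0 : hyperplane_val r (standard_config n s t) != 0.
  rewrite mulf_neq0 ?frame_val_standard //; apply/prodf_neq0 => j jn.
  rewrite (bigD1 ord_max) //= frame_coord_standard // eqxx.
  rewrite (eq_bigr (fun=> 1)) => [|k /andP[_ /negPf kn]]; last first.
    by rewrite frame_coord_standard // kn.
  suff -> : \sum_(k < n.+1 | (r <= k)%N && (k != ord_max)) 1 = c by [].
  rewrite big_mkcond big_ord_recr /= eqxx andbF addr0 -big_mkcond /=.
  rewrite (eq_bigl (fun k : 'I_n => r <= k)%N) => [|k]; last first.
    by rewrite -(inj_eq val_inj) /= ltn_eqF ?andbT.
  by have := big_geq_mkord (op := +%R) (idx := 0 : K) r n xpredT (fun=> 1); rewrite sumr_const_nat.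
apply: general_mono (general_neq0 (hyperplane_val_natural r) val0) => p _.
rewrite mulf_eq0 negb_or => /andP[up /prodf_neq0 Lp].
exact: hyperplane_effective.
Qed.

Lemma pairing_hyperplane (J : {set 'I_s}) :
  pairing n (hyperplane_through J) (hyperplane_through J) = n%:Z - 1 - #|J|%:Z.
Proof.
rewrite /pairing hyperplane_throughE /= !mulr1; congr (_ - _).
rewrite -sum1_card [in RHS]big_mkcond /= (big_morph Posz PoszD (erefl _)).
by apply: eq_bigr => j _; rewrite ffunE; case: ifP.
Qed.

Lemma adeg_hyperplane (J : {set 'I_s}) :
  adeg n (hyperplane_through J) = n.+1%:Z - #|J|%:Z.
Proof.
rewrite adegE // hyperplane_throughE /= !mulr1; congr (_ - _).
rewrite -sum1_card [in RHS]big_mkcond /= (big_morph Posz PoszD (erefl _)).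
by apply: eq_bigr => j _; rewrite ffunE; case: ifP.
Qed.

(** Being the class of a multiple of a prime divisor for general points is preserved by
    the simple reflections, and holds for hyperplanes; the two numbers are Weyl
    invariants. *)
Lemma weyl_divisor_is_divisorial i D : i \in [:: -1; 0; 1] -> weyl_divisor n i D ->
  for_general_points (fun p : config K n s => divisorial_class p i D).
Proof.
move=> i_range [w [J [W cJ ->]]]; have [sq lin] :=
  weyl_numeric n_gt1 n_lt_s (hyperplane_through J) W.
have : generally_effective (w (hyperplane_through J)).
  apply: (weyl_invariant n_gt1 n_lt_s generally_effective_perm generally_effective_cremona W _).1.
  apply: generally_effective_hyperplane.
  by move: i_range; rewrite !inE => /or3P[] /eqP ?; subst i; lia.
apply: general_mono => p _ eff; split=> //.
  by rewrite sq pairing_hyperplane cJ; lia.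
by rewrite lin adeg_hyperplane cJ; lia.
Qed.

(** Induction on the degree. In degree at least 2, sort the multiplicities; by Noether's
    inequality the Cremona transformation then gives a divisorial class of smaller
    degree, at the transformed points, which are again general. *)
Lemma divisorial_is_weyl_divisor i D : i \in [:: -1; 0; 1] ->
  for_general_points (fun p : config K n s => divisorial_class p i D -> weyl_divisor n i D).
Proof.
move=> i_range; have [N] : exists N : nat, D.1 < N%:Z by exists `|D.1|.+1%N; lia.
elim: N D => [|N IH] D leN.
  apply: general_all => p [eff sq lin].
  have [[j [r [r0 DE]]]|[d0 _]] := degree_of_effective eff; last by lia.
  by rewrite DE in sq *; exact: exceptional_multiple.
case: (boolP [&& 2 <= D.1, [forall j, 0 <= D.2 j <= D.1], pairing n D D == i & adeg n D == 2 + i]);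
  last first.
  move=> no; apply: general_all => p [eff sq lin].
  have [[j [r [r0 DE]]]|[d0 m_range]] := degree_of_effective eff.
    by rewrite DE in sq *; exact: exceptional_multiple.
  have d1 : D.1 = 1.
    move: no; rewrite sq lin !eqxx !andbT; case: leP => /=; last by lia.
    by move=> _ /negP[]; apply/forallP.
  exact: weyl_divisor_degree1.
case/and4P=> d2 /forallP m_range /eqP sq /eqP lin.
have [sg sorted_sg] := exists_sorting D; set C := perm_class sg D in sorted_sg.
have C_range j : 0 <= C.2 j <= C.1 by rewrite ffunE; exact: m_range.
have sqC : pairing n C C = i by rewrite pairing_perm.
have linC : adeg n C = 2 + i by rewrite adeg_perm.
have t_lt0 : cremona_shift n C < 0 by exact: (noether_inequality n_gt1 n_lt_s i_range).
have ltN : (cremona n C).1 < N%:Z.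
  by rewrite (cremonaE n_gt1 n_lt_s) /=; move: t_lt0 leN; rewrite /C /=; lia.
have := general_perm sg (general_cremona n_gt1 n_lt_s (IH _ ltN)).
apply: general_mono => p _ [rel Qp] [eff _ _].
apply: (weyl_divisor_perm n_gt1 n_lt_s (sg := sg)); apply: (weyl_divisor_cremona n_gt1 n_lt_s).
apply: Qp; split.
- apply: (effective_irreducible_cremona n_gt1 rel).
  exact: effective_irreducible_perm.
- by rewrite (pairing_cremona n_gt1 n_lt_s).
- by rewrite (adeg_cremona n_gt1 n_lt_s).
Qed.

Lemma general_divisorial_iff_weyl i D : i \in [:: -1; 0; 1] ->
  for_general_points (fun p : config K n s => divisorial_class p i D <-> weyl_divisor n i D).
Proof.
move=> i_range; have := divisorial_is_weyl_divisor D i_range.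
have [W|notW] := excluded_middle_informative (weyl_divisor n i D).
  by move=> _; apply: general_mono (weyl_divisor_is_divisorial i_range W) => p _ div; split.
by apply: general_mono => p _ divW; split.
Qed.

(** The lattice is countable; choose one polynomial for each class. *)
Lemma very_general_countable (Q : Pic s -> config K n s -> Prop) :
  (forall D, for_general_points (Q D)) ->
  for_very_general_points (fun p => forall D, Q D p).
Proof.
move=> gQ; pose G D := constructive_indefinite_description _
  (let: ex_intro2 G G0 GQ := gQ D in ex_intro (fun G => G != 0 /\ forall p,
     homogeneous_coordinates p -> nonvanishing G p -> Q D p) G (conj G0 GQ)).
exists (fun r => if unpickle r is Some D then sval (G D) else 1) => [r|p hp Gp D].
  by case: unpickle => [D|]; [case: (svalP (G D))|exact: oner_neq0].
have [_ GQ] := svalP (G D); apply: GQ => //.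
by have := Gp (pickle D); rewrite pickleK.
Qed.

Lemma weyl_divisor_transitive i D D' : weyl_divisor n i D -> weyl_divisor n i D' ->
  exists2 w, weyl_group n w & w D = D'.
Proof.
move=> [w [J [W cJ ->]]] [w' [J' [W' cJ' ->]]].
have [v [V vw _]] := weyl_inverse n_gt1 n_lt_s W.
have [sg JJ'] : exists sg : 'S_s, sg @^-1: J = J'.
  by apply: perm_of_card; have [] : #|J|%:Z = #|J'|%:Z by rewrite cJ cJ'.
have [u U uE] := weyl_perm n_gt1 n_lt_s sg.
exists (w' \o (u \o v)); first by do 2![apply: weyl_comp => //].
by rewrite /= vw uE perm_hyperplane JJ'.
Qed.

End Main.

Theorem theorem0p7 (K : closedFieldType) (n s : nat) (i : int)
    (n_ge2 : (2 <= n)%N) (s_gtn : (n + 1 <= s)%N)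
    (i_range : i \in [:: -1; 0; 1]) :
  (forall D : Pic s,
     for_general_points (fun p : config K n s =>
       divisorial_class p i D <-> weyl_divisor n i D)) /\
  for_very_general_points (fun p : config K n s =>
    (forall D : Pic s, divisorial_class p i D <-> weyl_divisor n i D) /\
    weyl_acts_transitively n (divisorial_class p i)).
Proof.
have n_lt_s : (n.+1 <= s)%N by rewrite -addn1.
have gen D := @general_divisorial_iff_weyl K n s n_ge2 n_lt_s i D i_range.
split=> //; have [G G0 GQ] := very_general_countable gen.
exists G => // p hp Gp; have divW := GQ p hp Gp; split=> //.
split=> [w D W /divW WD|D D' /divW WD /divW WD'].
  by apply/divW; exact: weyl_divisor_weyl.
exact: (weyl_divisor_transitive n_ge2 n_lt_s WD WD').
Qed.
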